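(* Let $\mathbb{R}^n=\mathbb{R}^{2d}$ be endowed with its canonical symplectic form and associated Poisson bracket, and let $A,B\in\operatorname{Sym}(n,\mathbb{R})$ form a non-dissipative pair. Define $C\in\operatorname{Sym}(n,\mathbb{R})$ by $Q_C:=\{Q_A,Q_B\}$, and assume $A,B,C$ are linearly independent. Suppose one of the following holds: (i) $\operatorname{minrank}\{A,B\}\ge3$ and $\operatorname{maxrank}\{A,B\}\ge17$; (ii) $\operatorname{minrank}\{A,B\}=2$, $\operatorname{maxrank}\{A,B\}\ge9$, and $\ker A\cap\ker B$ is either $\{0\}$ or a symplectic subspace of $\mathbb{R}^n$. Then there exists $x\in\mathbb{R}^n$ with $Q_A(x)=Q_B(x)=0$ and $Q_C(x)\ne0$.
   Context: $Q_M(z)={}^tzMz$ for $M\in\operatorname{Sym}(n,\mathbb{R})$. Canonical symplectic structure on $\mathbb{R}^{2d}$ with coordinates $(x,\xi)$: $\sigma=\sum_j d\xi_j\wedge dx_j$, Poisson bracket $\{a,b\}=\sum_j(\partial_{\xi_j}a\,\partial_{x_j}b-\partial_{x_j}a\,\partial_{\xi_j}b)$. $A,B$ form a non-dissipative pair if $0$ is the only positive semidefinite element of $\operatorname{span}_{\mathbb{R}}\{A,B\}$. $\operatorname{maxrank}\{A,B\}$ is the maximal rank of elements of $\operatorname{span}_{\mathbb{R}}\{A,B\}$; $\operatorname{minrank}\{A,B\}$ is the minimal rank of nonzero elements of it. *)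

(* Defs.v *)
From HB Require Import structures.
From mathcomp Require Import all_boot all_order all_algebra.
From mathcomp Require Import all_classical all_reals all_analysis.
Set Implicit Arguments. Unset Strict Implicit. Unset Printing Implicit Defensive.
Import Order.TTheory GRing.Theory Num.Theory.
Import numFieldNormedType.Exports.
Local Open Scope ring_scope.

Section Defs.
Variable R : realType.

Definition Qf (n : nat) (M : 'M[R]_n) (z : 'cV[R]_n) : R := (z^T *m M *m z) 0 0.

(* Coordinates on R^{2d}: z = (x, xi), x_j = z (lshift d j), xi_j = z (rshift d j) *)
Definition ecoord (n : nat) (i : 'I_n) : 'cV[R]_n := delta_mx i 0.
Definition dx (d : nat) (j : 'I_d) : 'cV[R]_(d + d) := ecoord (lshift d j).
Definition dxi (d : nat) (j : 'I_d) : 'cV[R]_(d + d) := ecoord (rshift d j).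

Definition pbracket (d : nat) (a b : 'cV[R]_(d + d) -> R) (z : 'cV[R]_(d + d)) : R :=
  \sum_(j < d) ('D_(dxi j) a z * 'D_(dx j) b z - 'D_(dx j) a z * 'D_(dxi j) b z).

Definition sigma (d : nat) (z w : 'cV[R]_(d + d)) : R :=
  \sum_(j < d) (z (rshift d j) 0 * w (lshift d j) 0 - z (lshift d j) 0 * w (rshift d j) 0).

Definition symmx (n : nat) (M : 'M[R]_n) : Prop := M^T = M.

Definition psd (n : nat) (M : 'M[R]_n) : Prop := forall z, 0 <= Qf M z.

Definition in_span2 (n : nat) (A B M : 'M[R]_n) : Prop :=
  exists s t : R, M = s *: A + t *: B.

Definition nondissipative (n : nat) (A B : 'M[R]_n) : Prop :=
  forall M, in_span2 A B M -> psd M -> M = 0.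

Definition maxrank (n : nat) (A B : 'M[R]_n) : nat :=
  \max_(r < n.+1 | `[< exists M, in_span2 A B M /\ \rank M = r >]) r.

Definition minrank (n : nat) (A B : 'M[R]_n) : nat :=
  \big[minn/n]_(r < n.+1 | `[< exists M, [/\ in_span2 A B M, M != 0 & \rank M = r] >]) r.

Definition linindep3 (n : nat) (A B C : 'M[R]_n) : Prop :=
  forall a b c : R, a *: A + b *: B + c *: C = 0 -> [/\ a = 0, b = 0 & c = 0].

Definition in_kerAB (n : nat) (A B : 'M[R]_n) (z : 'cV[R]_n) : Prop :=
  A *m z = 0 /\ B *m z = 0.

Definition kerAB_trivial (n : nat) (A B : 'M[R]_n) : Prop :=
  forall z, in_kerAB A B z -> z = 0.

Definition kerAB_symplectic (d : nat) (A B : 'M[R]_(d + d)) : Prop :=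
  forall z, in_kerAB A B z -> (forall w, in_kerAB A B w -> sigma z w = 0) -> z = 0.

End Defs.

(* Main.v *)
Require Import Defs.
From HB Require Import structures.
From mathcomp Require Import all_boot all_order all_algebra.
From mathcomp Require Import all_classical all_reals all_analysis.
From mathcomp Require Import zify ring lra.
Set Implicit Arguments.
Unset Strict Implicit.
Unset Printing Implicit Defensive.
Import Order.TTheory GRing.Theory Num.Theory.
Import numFieldNormedType.Exports.
Local Open Scope ring_scope.

(** Suppose that [Qf C] vanishes on the common zeros of [Qf A] and [Qf B]; the
    contradiction sought is that [C] lies in the span of [A] and [B].

    Minimal rank at least 3.  By connectedness some member of the pencil, say
    [B], has both indices of inertia at least 2.  The S-lemma then gives a common
    zero [y], which can be chosen regular.  Put [a = bf A y] and [b = bf B y].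
    Tangency shows that [bf C y] is a combination of [a] and [b], so one may
    assume [bf C y = 0].  Projecting from [y], [Qf C] vanishes where
    [a Qf B = b Qf A]; that is, on each hyperplane [b + s a = 0], it vanishes on
    the isotropic cone of [B + s A].  For small [s] this form is indefinite
    there, hence [Qf C] is proportional to it.  Evaluating the factor at a
    vector [e] tangent at [y] gives the cubic identity
    [(a Qf B(e) - b Qf A(e)) Qf C = Qf C(e) (a Qf B - b Qf A)].  If [C <> 0], the
    member of the pencil that vanishes at [e] also vanishes on a hyperplane and
    has rank at most 2.

    Minimal rank 2.  Now some member is [A = r1 r2^T + r2 r1^T], so [Qf C] is a
    multiple of [r2 {r1, Qf B} + r1 {r2, Qf B}].  If [B] is indefinite on
    [r1 = 0], then [{r1, Qf B}] is a multiple of [r1], and likewise for [r2]; if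
    both hold then [C] is a multiple of [A].  If [B] is semidefinite on [r2 = 0]
    only, the Hamiltonian vector of [r1] either makes a member of the pencil
    semidefinite or lies in the radical of the common kernel.  If [B] is
    semidefinite on both hyperplanes, the S-lemma contradicts
    non-dissipativity. *)

(** * Quadratic forms and ranks *)

Section BilinearForm.
Variables (R : realType) (n : nat).
Implicit Types (M N : 'M[R]_n) (x y z : 'cV[R]_n) (s t : R).

Definition bf M x y : R := (x^T *m M *m y) 0 0.

Lemma QfE M x : Qf M x = bf M x x. Proof. by []. Qed.

Lemma bfDl M x y z : bf M (x + y) z = bf M x z + bf M y z.
Proof. by rewrite /bf linearD /= !mulmxDl mxE. Qed.

Lemma bfDr M x y z : bf M x (y + z) = bf M x y + bf M x z.
Proof. by rewrite /bf mulmxDr mxE. Qed.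

Lemma bfZl M s x y : bf M (s *: x) y = s * bf M x y.
Proof. by rewrite /bf linearZ /= -!scalemxAl mxE. Qed.

Lemma bfZr M s x y : bf M x (s *: y) = s * bf M x y.
Proof. by rewrite /bf -scalemxAr mxE. Qed.

Lemma bfNl M x y : bf M (- x) y = - bf M x y.
Proof. by rewrite -scaleN1r bfZl mulN1r. Qed.

Lemma bfNr M x y : bf M x (- y) = - bf M x y.
Proof. by rewrite -scaleN1r bfZr mulN1r. Qed.

Lemma bfMD M N x y : bf (M + N) x y = bf M x y + bf N x y.
Proof. by rewrite /bf mulmxDr mulmxDl mxE. Qed.

Lemma bfMZ M s x y : bf (s *: M) x y = s * bf M x y.
Proof. by rewrite /bf -scalemxAr -scalemxAl mxE. Qed.

Lemma bfMN M x y : bf (- M) x y = - bf M x y.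
Proof. by rewrite -scaleN1r bfMZ mulN1r. Qed.

Definition bfE := (bfDl, bfDr, bfZl, bfZr, bfNl, bfNr, bfMD, bfMZ, bfMN).

Lemma bfC M x y : symmx M -> bf M x y = bf M y x.
Proof.
move=> sM; rewrite /bf.
have -> : (x^T *m M *m y) 0 0 = ((x^T *m M *m y)^T) 0 0 by rewrite [RHS]mxE.
by rewrite !trmx_mul trmxK sM mulmxA.
Qed.

Lemma symmxD M N : symmx M -> symmx N -> symmx (M + N).
Proof. by rewrite /symmx linearD /= => -> ->. Qed.

Lemma symmxZ s M : symmx M -> symmx (s *: M).
Proof. by rewrite /symmx linearZ /= => ->. Qed.

Lemma symmxN M : symmx M -> symmx (- M).
Proof. by move=> ?; rewrite -scaleN1r; apply: symmxZ. Qed.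

Definition dot x y : R := (x^T *m y) 0 0.

Lemma dotDr x y z : dot x (y + z) = dot x y + dot x z.
Proof. by rewrite /dot mulmxDr mxE. Qed.

Lemma dotZr s x y : dot x (s *: y) = s * dot x y.
Proof. by rewrite /dot -scalemxAr mxE. Qed.

Lemma dotC x y : dot x y = dot y x.
Proof. by rewrite /dot !mxE; apply: eq_bigr => i _; rewrite !mxE mulrC. Qed.

Lemma dot_eq0 x : dot x x = 0 -> x = 0.
Proof.
rewrite /dot mxE => /eqP; rewrite psumr_eq0 => [/allP h|i _]; last first.
  by rewrite mxE -expr2 sqr_ge0.
apply/matrixP => i j; rewrite ord1 [RHS]mxE.
have := h i (mem_index_enum _); rewrite mxE -expr2 sqrf_eq0 => /eqP //.
Qed.

Lemma bf_dotl M x y : symmx M -> bf M x y = dot (M *m x) y.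
Proof. by move=> sM; rewrite /bf /dot trmx_mul sM. Qed.

Lemma bf_dotr M x y : bf M x y = dot x (M *m y).
Proof. by rewrite /bf /dot mulmxA. Qed.

Lemma bf_ker M x : symmx M -> (forall y, bf M x y = 0) -> M *m x = 0.
Proof. by move=> sM h; apply: dot_eq0; rewrite -bf_dotl. Qed.

Lemma ker_bf M x y : symmx M -> M *m x = 0 -> bf M x y = 0.
Proof. by move=> sM h; rewrite bf_dotl // h /dot trmx0 mul0mx mxE. Qed.

Lemma Qf_eq0_mx M : symmx M -> (forall x, Qf M x = 0) -> M = 0.
Proof.
move=> sM h; have h2 x y : bf M x y = 0.
  have := h (x + y); rewrite QfE !bfE -!QfE !h (bfC y x) //; lra.
apply/matrixP => i j; rewrite [RHS]mxE.
have -> : M i j = (M *m delta_mx j 0 : 'cV_n) i 0 by rewrite -colE mxE.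
by rewrite (bf_ker sM) ?mxE.
Qed.

Lemma QfDZ M x y t : symmx M ->
  Qf M (x + t *: y) = Qf M x + (2 * bf M x y) * t + Qf M y * t ^+ 2.
Proof. move=> sM; rewrite !QfE !bfE (bfC y x) //; ring. Qed.

(** [M] maps the kernel of [K] into its annihilator, of dimension at most [k], and passing from that
    kernel to the whole space adds at most [k] to the rank. *)
Lemma rank_vanishing_form (k : nat) (K : 'M[R]_(k, n)) M : symmx M ->
  (forall x, K *m x = 0 -> Qf M x = 0) -> (\rank M <= k + k)%N.
Proof.
(* [kermx] is a left kernel, hence the transposes: the columns of [Z] span the kernel of [K]. *)
move=> sM h; pose Z : 'M[R]_n := (kermx K^T)^T.
have KZ : K *m Z = 0.
  by apply: trmx_inj; rewrite trmx_mul trmxK trmx0 mulmx_ker.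
have ZMZ : Z^T *m M *m Z = 0.
  apply: Qf_eq0_mx; first by rewrite /symmx !trmx_mul trmxK sM mulmxA.
  move=> x; rewrite /Qf; have := h (Z *m x); rewrite /Qf trmx_mul !mulmxA KZ mul0mx.
  by apply.
have rZ : (n <= \rank Z + k)%N.
  have := rank_leq_row K; rewrite mxrank_tr mxrank_ker mxrank_tr; lia.
have h2 : (\rank M + \rank Z - n <= \rank (M *m Z))%N by exact: mxrank_mul_min.
have h1 : (\rank Z + \rank (M *m Z) - n <= 0)%N.
  by rewrite -(mxrank_tr Z) -(mxrank0 R n n) -ZMZ -mulmxA; exact: mxrank_mul_min.
lia.
Qed.

Lemma rank_kernel_bound (k : nat) (K : 'M[R]_(k, n)) M :
  (forall x, K *m x = 0 -> M *m x = 0) -> (\rank M <= k)%N.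
Proof.
move=> h; pose Z : 'M[R]_n := (kermx K^T)^T.
have KZ : K *m Z = 0.
  by apply: trmx_inj; rewrite trmx_mul trmxK trmx0 mulmx_ker.
have MZ : M *m Z = 0.
  apply/matrixP => i j; have := h (col j Z).
  rewrite !colE !mulmxA KZ mul0mx => /(_ erefl) /matrixP /(_ i 0).
  by rewrite -colE !mxE.
have rZ : (n <= \rank Z + k)%N.
  have := rank_leq_row K; rewrite mxrank_tr mxrank_ker mxrank_tr; lia.
have := mxrank_mul_min M Z; rewrite MZ mxrank0; lia.
Qed.

End BilinearForm.

(** * Polynomials near the origin *)

Section SmallPerturbations.
Variable R : realType.
Implicit Types (d k t : R) (P : R -> Prop).

Lemma near0_exists P : (\forall t \near (0 : R), P t) ->
  exists2 d, 0 < d & forall t, `|t| <= d -> P t.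
Proof.
case/nbhs_ballP => d /= d0 h; exists (d / 2); first lra.
move=> t td; apply: h; rewrite /ball /= sub0r normrN; lra.
Qed.

Lemma near0_intro P d : 0 < d -> (forall t, `|t| <= d -> P t) ->
  \forall t \near (0 : R), P t.
Proof.
move=> d0 h; apply/nbhs_ballP; exists d => //= t.
by rewrite /ball /= sub0r normrN => /ltW /h.
Qed.

(** One radius serves all coefficients bounded by [K], as is needed when they depend on a second
    parameter. The radius [k0 / D] is at most 1, and [3 * K] times it stays below [k0]. *)
Lemma cubic_pos_uniform k0 K : 0 < k0 -> 0 <= K ->
  exists2 d, 0 < d <= 1 & forall k1 k2 k3 t, `|k1| <= K -> `|k2| <= K ->
    `|k3| <= K -> `|t| <= d -> 0 < k0 + k1 * t + k2 * t ^+ 2 + k3 * t ^+ 3.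
Proof.
move=> k00 K0; pose D := 3 * K + 1 + k0; have D0 : 0 < D by rewrite /D; lra.
exists (k0 / D).
  by rewrite divr_gt0 //= ler_pdivrMr // mul1r /D; lra.
move=> k1 k2 k3 t h1 h2 h3 ht.
have t1 : `|t| <= 1.
  by apply: le_trans ht _; rewrite ler_pdivrMr // mul1r /D; lra.
have t0 := normr_ge0 t.
have e : `|k1 + k2 * t + k3 * t ^+ 2| <= 3 * K.
  apply: le_trans (ler_normD _ _) _; rewrite normrM normrX.
  apply: le_trans (lerD (ler_normD _ _) (lexx _)) _; rewrite normrM.
  have := normr_ge0 k2; have := normr_ge0 k3.
  have : `|t| ^+ 2 <= 1 by rewrite expr_le1.
  have := sqr_ge0 `|t|.
  nra.
have : `|(k1 + k2 * t + k3 * t ^+ 2) * t| < k0.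
  rewrite normrM; apply: (@le_lt_trans _ _ (3 * K * (k0 / D))).
    by apply: ler_pM.
  rewrite mulrA ltr_pdivrMr // /D; nra.
rewrite ltr_norml => /andP[h _].
have -> : k0 + k1 * t + k2 * t ^+ 2 + k3 * t ^+ 3 =
          k0 + (k1 + k2 * t + k3 * t ^+ 2) * t by ring.
lra.
Qed.

Lemma near0_cubic_gt0 k0 k1 k2 k3 : 0 < k0 ->
  \forall t \near (0 : R), 0 < k0 + k1 * t + k2 * t ^+ 2 + k3 * t ^+ 3.
Proof.
move=> k00; pose K := `|k1| + `|k2| + `|k3|.
have := normr_ge0 k1; have := normr_ge0 k2; have := normr_ge0 k3 => a1 a2 a3.
have [|d /andP[d0 _] h] := @cubic_pos_uniform k0 K k00; first by rewrite /K; lra.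
by apply: (near0_intro d0) => t; apply: h; rewrite /K; lra.
Qed.

Lemma near0_quad_gt0 k0 k1 k2 : 0 < k0 ->
  \forall t \near (0 : R), 0 < k0 + k1 * t + k2 * t ^+ 2.
Proof.
move=> /(near0_cubic_gt0 k1 k2 0); apply: filterS => t; lra.
Qed.

(** The values at [0], [d], [- d] and [d / 2] determine a cubic. Identities known only near a point
    are extended by reading off coefficients in this way. *)
Lemma near0_cubic_eq0 k0 k1 k2 k3 :
  (\forall t \near (0 : R), k0 + k1 * t + k2 * t ^+ 2 + k3 * t ^+ 3 = 0) ->
  [/\ k0 = 0, k1 = 0, k2 = 0 & k3 = 0].
Proof.
case/near0_exists => d d0 h.
have e0 : k0 = 0 by have := h 0; rewrite normr0 => /(_ (ltW d0)); lra.
have [e1 e2] : k0 + k1 * d + k2 * d ^+ 2 + k3 * d ^+ 3 = 0 /\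
   k0 + k1 * (- d) + k2 * (- d) ^+ 2 + k3 * (- d) ^+ 3 = 0.
  by split; apply: h; rewrite ?normrN gtr0_norm.
have e3 : k0 + k1 * (d / 2) + k2 * (d / 2) ^+ 2 + k3 * (d / 2) ^+ 3 = 0.
  by apply: h; rewrite gtr0_norm; lra.
have dn : d != 0 by rewrite gt_eqF.
have f2 : k2 = 0.
  apply: (mulIf (expf_neq0 2 dn)); rewrite mul0r; lra.
have f3 : k3 = 0.
  apply: (mulIf (expf_neq0 3 dn)); rewrite mul0r.
  have : (d / 2) ^+ 3 = d ^+ 3 / 8 by field.
  have : (d / 2) ^+ 2 = d ^+ 2 / 4 by field.
  have : (- d) ^+ 3 = - d ^+ 3 by ring.
  move=> q1 q2 q3; move: e1 e2 e3; rewrite e0 f2 q1 q2 q3; lra.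
split=> //; apply: (mulIf dn); rewrite mul0r.
by move: e1; rewrite e0 f2 f3; lra.
Qed.

Lemma near0_quad_eq0 k0 k1 k2 :
  (\forall t \near (0 : R), k0 + k1 * t + k2 * t ^+ 2 = 0) ->
  [/\ k0 = 0, k1 = 0 & k2 = 0].
Proof.
move=> h; have [] // := @near0_cubic_eq0 k0 k1 k2 0.
by apply: filterS h => t ht; rewrite mul0r addr0.
Qed.

Lemma quad_roots (a b c : R) : 0 < a -> c < 0 ->
  exists t1 t2, [/\ t1 < 0 < t2, c + 2 * b * t1 + a * t1 ^+ 2 = 0 &
                    c + 2 * b * t2 + a * t2 ^+ 2 = 0].
Proof.
move=> a0 c0; pose D := b ^+ 2 - a * c.
have bD : b ^+ 2 < D by rewrite /D; nra.
have D0 : 0 <= D by apply: le_trans (ltW bD); apply: sqr_ge0.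
have s2 := sqr_sqrtr D0; set s := Num.sqrt D in s2.
have s0 : 0 <= s by apply: sqrtr_ge0.
have bs : `|b| < s.
  by rewrite -(@ltr_pXn2r _ 2) ?nnegrE // s2 real_normK ?num_real.
move: bs; rewrite ltr_norml => /andP[bs1 bs2].
have an : a != 0 by rewrite gt_eqF.
have key (e : R) : e ^+ 2 = D -> c + 2 * b * ((- b + e) / a) + a * ((- b + e) / a) ^+ 2 = 0.
  move=> eD; have -> : c + 2 * b * ((- b + e) / a) + a * ((- b + e) / a) ^+ 2 =
     (e ^+ 2 - D) / a by rewrite /D; field.
  by rewrite eD subrr mul0r.
exists ((- b + - s) / a), ((- b + s) / a); split; last 2 first.
- by apply: key; rewrite sqrrN.
- exact: key.
by rewrite pmulr_llt0 ?invr_gt0 // divr_gt0 // ?andbT; lra.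
Qed.

End SmallPerturbations.

(** * Indefinite forms *)

Section IndefiniteForms.
Variables (R : realType) (n : nat).
Implicit Types (M N A B C : 'M[R]_n) (x y z u v w p h : 'cV[R]_n) (s t : R).

Lemma isotropic_on_line M p w : symmx M -> 0 < Qf M p -> Qf M w < 0 ->
  exists t1 t2, [/\ t1 < 0 < t2, Qf M (w + t1 *: p) = 0 & Qf M (w + t2 *: p) = 0].
Proof.
move=> sM p0 w0; have [t1 [t2 [t12 e1 e2]]] := quad_roots (bf M w p) p0 w0.
by exists t1, t2; split=> //; rewrite QfDZ.
Qed.

(** Otherwise pairing with [w] and with [p] gives [Qf M w = t ^+ 2 * Qf M p], against the signs. *)
Lemma isotropic_on_line_nker M p w t : symmx M -> 0 < Qf M p -> Qf M w < 0 ->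
  M *m (w + t *: p) != 0.
Proof.
move=> sM p0 w0; apply/eqP => h.
have := ker_bf w sM h; have := ker_bf p sM h.
rewrite !bfE -!QfE (bfC p w sM) => e1 e2.
have eb : bf M w p = - (t * Qf M p) by lra.
have : t ^+ 2 * Qf M p = Qf M w by move: e2; rewrite eb; lra.
have : 0 <= t ^+ 2 by apply: sqr_ge0.
nra.
Qed.

(** The ratio of [Qf A] to [Qf B] is never larger where [Qf B < 0] than where [Qf B > 0]; minus the
    supremum of the former values serves as [t]. *)
Lemma S_lemma A B u w : symmx A -> symmx B -> 0 < Qf B u -> Qf B w < 0 ->
  (forall x, Qf B x = 0 -> 0 <= Qf A x) -> exists t, psd (A + t *: B).
Proof.
move=> sA sB u0 w0 h.
have ratio p q : 0 < Qf B p -> Qf B q < 0 ->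
    Qf A q / Qf B q <= Qf A p / Qf B p.
  move=> p0 q0; set k := Qf A q / Qf B q.
  have ek : Qf A q = k * Qf B q by rewrite /k divfK ?lt_eqF.
  have [t1 [t2 [/andP[t10 t20] e1 e2]]] := isotropic_on_line sB p0 q0.
  have := h _ e1; have := h _ e2; move: e1 e2; rewrite !QfDZ // ek.
  rewrite ler_pdivlMr //.
  (* On the line [q + t *: p] the form [A - k *: B] has no constant term; being nonnegative at
     [t1 < 0] and at [t2 > 0], it has a nonnegative leading coefficient. *)
  set b := bf A q p; set b' := bf B q p; move=> e1 e2 f2 f1.
  have g2 : 0 <= t2 * (2 * (b - k * b') + t2 * (Qf A p - k * Qf B p)) by nra.
  have g1 : 0 <= t1 * (2 * (b - k * b') + t1 * (Qf A p - k * Qf B p)) by nra.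
  rewrite pmulr_rge0 // in g2; rewrite nmulr_rge0 // in g1.
  nra.
pose S := [set Qf A q / Qf B q | q in [set q | Qf B q < 0]]%classic.
have S0 : (S !=set0)%classic by exists (Qf A w / Qf B w), w.
have Sub p : 0 < Qf B p -> ubound S (Qf A p / Qf B p).
  by move=> p0 _ [q q0 <-]; apply: ratio.
exists (- sup S) => x; rewrite QfE !bfE -!QfE mulNr subr_ge0.
have [x0|x0|x0] := ltgtP (Qf B x) 0.
- rewrite -ler_ndivrMr //; apply: ub_le_sup; last by exists x.
  by exists (Qf A u / Qf B u); apply: Sub.
- rewrite -ler_pdivlMr //; apply: ge_sup => //; exact: Sub.
- by rewrite x0 mulr0; apply: h.
Qed.

Section Proportional.
Variables (V : 'cV[R]_n -> Prop) (l : 'cV[R]_n -> R) (Q Q' : 'M[R]_n).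
Hypotheses (VD : forall x y t, V x -> V y -> V (x + t *: y))
  (lD : forall x y t, l (x + t *: y) = l x + t * l y)
  (sQ : symmx Q) (sQ' : symmx Q')
  (Q'0 : forall x, V x -> Qf Q x = 0 -> l x != 0 -> Qf Q' x = 0).

(* [transv p w != 0] says that the point where the line [(p w)] meets
   [l = 0] is not isotropic. *)
Let transv p w : R :=
  l w ^+ 2 * Qf Q p - 2 * l w * l p * bf Q p w + l p ^+ 2 * Qf Q w.

(** On this line both forms are quadratics in [t] with the same two distinct roots. [transv] keeps
    the roots off [l = 0], where [Q'0] says nothing. *)
Let ratio p w : V p -> V w -> 0 < Qf Q p -> Qf Q w < 0 -> transv p w != 0 ->
  Qf Q' p * Qf Q w = Qf Q' w * Qf Q p.
Proof.
move=> Vp Vw p0 w0 hT.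
have [t1 [t2 [/andP[t10 t20] e1 e2]]] := isotropic_on_line sQ p0 w0.
have van t : Qf Q (w + t *: p) = 0 -> Qf Q' (w + t *: p) = 0.
  move=> e; apply: Q'0 => //; first exact: VD.
  apply: contraNneq hT; rewrite lD => lw; apply/eqP.
  move: e; rewrite QfDZ // (bfC w p sQ) /transv => e.
  have -> : l w = - (t * l p) by lra.
  transitivity (l p ^+ 2 * (Qf Q w + 2 * bf Q p w * t + Qf Q p * t ^+ 2)).
    ring.
  by rewrite e mulr0.
have f1 := van _ e1; have f2 := van _ e2; move: f1 f2 e1 e2; rewrite !QfDZ //.
set b := bf Q w p; set b' := bf Q' w p; move=> f1 f2 e1 e2.
pose c0 := Qf Q' p * Qf Q w - Qf Q' w * Qf Q p.
pose c1 := 2 * (Qf Q' p * b - Qf Q p * b').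
have g t : Qf Q' w + 2 * b' * t + Qf Q' p * t ^+ 2 = 0 ->
   Qf Q w + 2 * b * t + Qf Q p * t ^+ 2 = 0 -> c0 + t * c1 = 0.
  move=> q1 q2; transitivity (Qf Q' p * (Qf Q w + 2 * b * t + Qf Q p * t ^+ 2) -
     Qf Q p * (Qf Q' w + 2 * b' * t + Qf Q' p * t ^+ 2)).
    rewrite /c0 /c1; ring.
  by rewrite q1 q2 !mulr0 subr0.
have g1 := g _ f1 e1; have g2 := g _ f2 e2.
have c10 : c1 = 0.
  apply: (mulfI (_ : t2 - t1 != 0)); last lra.
  by rewrite gt_eqF //; lra.
by apply/eqP; rewrite -subr_eq0 -/c0; apply/eqP; move: g1; rewrite c10; lra.
Qed.

(** [V] stands for a subspace and [l] for a linear form on it. The vectors [e0] and [e] move [w] and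
    [p] into general position, so that [ratio] applies. *)
Lemma form_proportional p w e e0 : V p -> V w -> V e -> V e0 ->
  0 < Qf Q p -> Qf Q w < 0 -> l e = 0 -> Qf Q e != 0 -> l e0 != 0 ->
  exists k, forall x, V x -> Qf Q' x = k * Qf Q x.
Proof.
move=> Vp Vw Ve Ve0 p0 w0 le Qe le0.
(* A small step along [e0] leaves [l = 0] and keeps the sign of [Qf Q]. *)
have [w1 [Vw1 w10 lw1]] : exists w1, [/\ V w1, Qf Q w1 < 0 & l w1 != 0].
  have [lw|] := eqVneq (l w) 0; last by exists w.
  have [|d d0 h] := near0_exists (near0_quad_gt0 (- (2 * bf Q w e0)) (- Qf Q e0)
    (_ : 0 < - Qf Q w)); first by rewrite oppr_gt0.
  exists (w + d *: e0); split; first exact: VD.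
    have := h d; rewrite gtr0_norm // => /(_ (lexx _)); rewrite QfDZ //; lra.
  by rewrite lD lw add0r mulf_neq0 // gt_eqF.
(* If every [p + t *: e] failed, the coefficient [l w1 ^+ 2 * Qf Q e] of [t ^+ 2] in [transv] would
   vanish. *)
have [p1 [Vp1 p10 hT]] : exists p1, [/\ V p1, 0 < Qf Q p1 & transv p1 w1 != 0].
  apply: contrapT => nex.
  suff : \forall t \near (0 : R), transv p w1 +
      (l w1 ^+ 2 * (2 * bf Q p e) - 2 * l w1 * l p * bf Q e w1) * t +
      l w1 ^+ 2 * Qf Q e * t ^+ 2 = 0.
    case/near0_quad_eq0 => _ _ /eqP; apply/negP.
    by rewrite mulf_neq0 // expf_neq0.
  have := near0_quad_gt0 (2 * bf Q p e) (Qf Q e) p0.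
  apply: filterS => t pt; apply: contrapT => /eqP nt; apply: nex.
  exists (p + t *: e); split; [exact: VD | by rewrite QfDZ | ].
  move: nt; rewrite /transv lD le QfDZ // !bfE; congr (_ != _); ring.
pose k := Qf Q' w1 / Qf Q w1; exists k => x Vx.
(* The relation holds at [p1 + t *: x] for small [t]; its coefficient at [t ^+ 2] is the claim at
   [x]. *)
suff : \forall t \near (0 : R), (Qf Q' p1 - k * Qf Q p1) +
    (2 * (bf Q' p1 x - k * bf Q p1 x)) * t + (Qf Q' x - k * Qf Q x) * t ^+ 2 = 0.
  by case/near0_quad_eq0 => _ _ /eqP; rewrite subr_eq0 => /eqP.
have h1 := near0_quad_gt0 (2 * bf Q p1 x) (Qf Q x) p10.
have h2 : \forall t \near (0 : R), transv (p1 + t *: x) w1 != 0.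
  pose k1 := l w1 ^+ 2 * (2 * bf Q p1 x) - 2 * l w1 * (l p1 * bf Q x w1 + l x * bf Q p1 w1)
    + 2 * l p1 * l x * Qf Q w1.
  pose k2 := l w1 ^+ 2 * Qf Q x - 2 * l w1 * l x * bf Q x w1 + l x ^+ 2 * Qf Q w1.
  have E t : transv (p1 + t *: x) w1 = transv p1 w1 + k1 * t + k2 * t ^+ 2.
    by rewrite /transv lD QfDZ // !bfE /k1 /k2; ring.
  have [Tn|Tp|/eqP T0] := ltgtP (transv p1 w1) 0.
  - have := near0_quad_gt0 (- k1) (- k2) (_ : 0 < - transv p1 w1).
    rewrite oppr_gt0 => /(_ Tn); apply: filterS => t; rewrite E => ht.
    by rewrite lt_eqF //; lra.
  - have := near0_quad_gt0 k1 k2 Tp.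
    by apply: filterS => t; rewrite E => ht; rewrite gt_eqF.
  - by rewrite T0 in hT.
apply: filterS2 h1 h2 => t a1 a2.
have := ratio (VD t Vp1 Vx) Vw1 _ w10 a2; rewrite !QfDZ // => /(_ a1) r.
have ek : Qf Q' w1 = k * Qf Q w1 by rewrite /k divfK // lt_eqF.
apply: (mulIf (_ : Qf Q w1 != 0)); first by rewrite lt_eqF.
by rewrite mul0r; move: r; rewrite ek; lra.
Qed.

End Proportional.

End IndefiniteForms.

(** * Regular common zeros *)

Section RealConnected.
Local Open Scope classical_set_scope.

(** Otherwise [U] is the complement of [W]: clopen, nonempty and not the whole line. *)
Lemma real_open_cover_meet (R : realType) (U W : set R) : open U -> open W ->
  U !=set0 -> W !=set0 -> (forall x, U x \/ W x) -> exists x, U x /\ W x.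
Proof.
move=> oU oW U0 [y Wy] UW; apply: contrapT => nex.
have eU : U = ~` W.
  apply/seteqP; split=> x /=; first by move=> Ux Wx; apply: nex; exists x.
  by case: (UW x).
have conn : connected [set: R] by apply/connected_intervalP.
have UT : U = [set: R].
  apply: conn => //; first by exists U => //; rewrite setTI.
  by exists U; rewrite ?setTI // eU; apply: open_closedC.
have : U y by rewrite UT.
by rewrite eU.
Qed.

End RealConnected.

Section PencilZero.
Variables (R : realType) (n : nat).
Implicit Types (M N A B C : 'M[R]_n) (x y z u v w p h : 'cV[R]_n) (s t : R).

Definition indef M := (exists u, 0 < Qf M u) /\ (exists w, Qf M w < 0).

(* positive index of inertia at least 2 *)
Definition pos2 M := exists u v, 0 < Qf M u /\ bf M u v ^+ 2 < Qf M u * Qf M v.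

Lemma pos2Z M k : 0 < k -> pos2 (k *: M) -> pos2 M.
Proof.
move=> k0 [u [v []]]; rewrite !QfE !bfE -!QfE pmulr_rgt0 // => u0 h.
exists u, v; split=> //; rewrite -(ltr_pM2l (exprn_gt0 2 k0)).
by move: h; rewrite exprMn; lra.
Qed.

Lemma pos2_near M N : pos2 M -> \forall s \near (0 : R), pos2 (M + s *: N).
Proof.
case=> u [v [u0 uv]].
have h1 := near0_quad_gt0 (Qf N u) 0 u0.
rewrite -subr_gt0 in uv.
have h2 := near0_quad_gt0 (Qf M u * Qf N v + Qf N u * Qf M v - 2 * bf M u v * bf N u v)
  (Qf N u * Qf N v - bf N u v ^+ 2) uv.
apply: filterS2 h1 h2 => s a1 a2; exists u, v; rewrite !QfE !bfE -!QfE.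
split; first by move: a1; lra.
by rewrite -subr_gt0; move: a2; congr (_ < _); ring.
Qed.

(** A positive definite plane meets every hyperplane nontrivially. Multiplied by [Qf M u], the value
    at the witness is a positive multiple of a Gram determinant plus a square. *)
Lemma pos2_hyperplane M y : symmx M -> pos2 M ->
  exists x, 0 < Qf M x /\ bf M y x = 0.
Proof.
move=> sM [u [v [u0 uv]]].
have [mu|mu] := eqVneq (bf M y u) 0; first by exists u.
exists (bf M y u *: v + (- bf M y v) *: u); split; last by rewrite !bfE; ring.
rewrite QfDZ // QfE !bfE -!QfE -(pmulr_rgt0 _ u0) (bfC v u sM).
set a := bf M y u in mu *; set b := bf M y v.
have a2 : 0 < a ^+ 2 by rewrite exprn_even_gt0.
have -> : Qf M u * (a * (a * Qf M v) + 2 * (a * bf M u v) * - b + Qf M u * (- b) ^+ 2)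
  = a ^+ 2 * (Qf M u * Qf M v - bf M u v ^+ 2) + (a * bf M u v - b * Qf M u) ^+ 2 by ring.
by rewrite ltr_wpDr ?sqr_ge0 // mulr_gt0 // subr_gt0.
Qed.

(** If both indices of inertia were 1, the orthogonal complement of [u] and [w] would be totally
    isotropic, hence in the kernel of [M], and the rank at most 2. *)
Lemma pos2_rank3 M : symmx M -> indef M -> (2 < \rank M)%N -> pos2 M \/ pos2 (- M).
Proof.
move=> sM [[u u0] [w w0]] r3; apply: contrapT => /not_orP[np nn].
pose K : 'M[R]_(1 + 1, n) := col_mx (u^T *m M) (w^T *m M).
have KE x : K *m x = 0 -> bf M u x = 0 /\ bf M w x = 0.
  rewrite /K mul_col_mx => /eqP; rewrite col_mx_eq0 => /andP[/eqP h1 /eqP h2].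
  by rewrite /bf h1 h2 mxE.
have Q0 x : bf M u x = 0 -> bf M w x = 0 -> Qf M x = 0.
  move=> ux wx; have [xn|xpos|//] := ltgtP (Qf M x) 0.
    case: nn; exists w, x; rewrite !QfE !bfE -!QfE wx.
    by split; nra.
  by case: np; exists u, x; rewrite ux; split=> //; nra.
have polar0 x z : bf M u x = 0 -> bf M w x = 0 -> bf M u z = 0 -> bf M w z = 0 ->
    bf M x z = 0.
  move=> ux wx uz wz; have := Q0 (x + z); rewrite !bfDr ux wx uz wz addr0.
  by move=> /(_ erefl erefl); rewrite -(scale1r z) QfDZ // scale1r !Q0 //; lra.
suff : (\rank M <= 1 + 1)%N by rewrite leqNgt r3.
apply: (@rank_kernel_bound _ _ _ K) => x /KE[ux wx].
apply: bf_ker => // z.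
(* The Gram determinant [D] of [u] and [w] is negative, so [z] can be projected orthogonally to
   both. *)
pose g := bf M u w; pose D := Qf M u * Qf M w - g ^+ 2.
have D0 : D != 0 by rewrite lt_eqF // /D; have := sqr_ge0 g; nra.
pose al := (bf M u z * Qf M w - bf M w z * g) / D.
pose be := (bf M w z * Qf M u - bf M u z * g) / D.
pose z' := z - al *: u - be *: w.
have wu : bf M w u = g by rewrite (bfC w u).
have uz' : bf M u z' = 0.
  by rewrite /z' !bfE -!QfE -/g /al /be /D; field.
have wz' : bf M w z' = 0.
  by rewrite /z' !bfE -!QfE wu /al /be /D; field.
have : bf M x z' = 0 by apply: polar0.
by rewrite /z' !bfE (bfC x u) // (bfC x w) // ux wx; lra.
Qed.

(** By openness a small multiple of [B] can be added to [A] or [- A]; rescaling makes the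
    coefficient of [B] equal to 1. *)
Lemma pos2_member A B : pos2 A \/ pos2 (- A) -> exists s, pos2 (B + s *: A).
Proof.
case=> /(pos2_near B) /near0_exists[d d0 /(_ d)]; rewrite gtr0_norm // => /(_ (lexx _)) h.
  exists d^-1; apply: (pos2Z d0); move: h; congr pos2.
  by rewrite scalerDr scalerA mulfV ?gt_eqF // scale1r addrC.
exists (- d^-1); apply: (pos2Z d0); move: h; congr pos2.
by rewrite scalerDr scalerA mulrN mulfV ?gt_eqF // scaleN1r addrC.
Qed.

Lemma open_pos2 A B : open [set s : R | pos2 (B + s *: A)]%classic.
Proof.
rewrite openE => s /= /(pos2_near A) /near0_exists[d d0 h].
apply/nbhs_ballP; exists d => //= t; rewrite /ball /= distrC => /ltW /h.
by rewrite -addrA -scalerDl (addrC s) subrK.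
Qed.

(* The members of positive index >= 2 and those of negative index >= 2 form
   an open cover of the pencil, so some member has both. *)
Lemma mixed_member A B : symmx A -> symmx B ->
  indef A -> (2 < \rank A)%N ->
  (forall s, indef (B + s *: A)) -> (forall s, (2 < \rank (B + s *: A)%R)%N) ->
  exists s, pos2 (B + s *: A) /\ pos2 (- (B + s *: A)).
Proof.
move=> sA sB iA rA iB rB; have hA := pos2_rank3 sA iA rA.
pose W := [set s : R | pos2 (- B + s *: - A)]%classic.
have eN s : - B + s *: - A = - (B + s *: A) by rewrite scalerN opprD.
have [|||s [h1 h2]] := @real_open_cover_meet R _ W (@open_pos2 A B) (@open_pos2 (- A) (- B)).
- by have [s hs] := pos2_member B hA; exists s.
- have [|s hs] := @pos2_member (- A) (- B); last by exists s.
  by rewrite opprK; case: hA; [right | left].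
- move=> s; rewrite /W /= eN; apply: pos2_rank3; [|exact: iB|exact: rB].
  by apply: symmxD => //; apply: symmxZ.
by exists s; rewrite -eN.
Qed.

(** The hyperplane orthogonal to [x] contains vectors of both signs. Adding multiples of [x] changes
    no value of [Qf B] there and achieves orthogonality to [x']. *)
Lemma isotropic_orthogonal B x x' : symmx B -> pos2 B -> pos2 (- B) ->
  Qf B x = 0 -> bf B x x' != 0 ->
  exists z, [/\ Qf B z = 0, bf B x z = 0, bf B x' z = 0 & B *m z != 0].
Proof.
move=> sB pB nB x0 xx'.
pose orth u := u - (bf B x' u / bf B x x') *: x.
have oQ u : bf B x u = 0 -> Qf B (orth u) = Qf B u.
  by move=> xu; rewrite /orth QfE !bfE (bfC u x) // -!QfE xu x0; lra.
have o1 u : bf B x u = 0 -> bf B x (orth u) = 0.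
  by move=> xu; rewrite /orth !bfE -QfE xu x0; lra.
have o2 u : bf B x' (orth u) = 0.
  by rewrite /orth !bfE (bfC x' x) //; field.
have [u [u0 xu]] := pos2_hyperplane x sB pB.
have [w [w0 xw]] := pos2_hyperplane x (symmxN sB) nB.
rewrite !QfE !bfE -!QfE in w0 xw; have {}w0 : Qf B w < 0 by lra.
have {}xw : bf B x w = 0 by lra.
rewrite -oQ // in u0; rewrite -oQ // in w0.
have [t [_ [_ ez _]]] := isotropic_on_line sB u0 w0.
exists (orth w + t *: orth u); split=> //.
- by rewrite bfDr bfZr !o1 // mulr0 addr0.
- by rewrite bfDr bfZr !o2 // mulr0 addr0.
- exact: isotropic_on_line_nker.
Qed.

Lemma isotropic_plane_zero A B p w : symmx A -> symmx B ->
  Qf B p = 0 -> Qf B w = 0 -> bf B p w = 0 -> 0 < Qf A p -> Qf A w < 0 ->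
  exists y, [/\ Qf A y = 0, Qf B y = 0 & A *m y != 0].
Proof.
move=> sA sB p0 w0 pw Ap Aw; have [t [_ [_ ez _]]] := isotropic_on_line sA Ap Aw.
exists (w + t *: p); split=> //; last exact: isotropic_on_line_nker.
by rewrite QfDZ // (bfC w p) // p0 w0 pw; lra.
Qed.

(** The S-lemma gives [B]-isotropic points where [Qf A] has either sign. They are joined through a
    [B]-isotropic [z] orthogonal to both, and [Qf A] changes sign on one of the two isotropic planes
    unless it vanishes at [z]. *)
Lemma pencil_zero A B : symmx A -> symmx B -> pos2 B -> pos2 (- B) ->
  (forall t, ~ psd (A + t *: B)) -> (forall t, ~ psd (- A + t *: B)) ->
  exists y, [/\ Qf A y = 0, Qf B y = 0 & A *m y != 0 \/ B *m y != 0].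
Proof.
move=> sA sB pB nB nA nNA.
have [u [u0 _]] := pos2_hyperplane 0 sB pB.
have [w [w0 _]] := pos2_hyperplane 0 (symmxN sB) nB.
rewrite QfE bfMN -QfE oppr_gt0 in w0.
have [xneg [xm_0 Axm]] : exists x, Qf B x = 0 /\ Qf A x < 0.
  apply: contrapT => nex; case: (S_lemma sA sB u0 w0) => [x x0|t /nA//].
  by rewrite leNgt; apply/negP => ?; apply: nex; exists x.
have [xpos [xp_0 Axp]] : exists x, Qf B x = 0 /\ 0 < Qf A x.
  apply: contrapT => nex; case: (S_lemma (symmxN sA) sB u0 w0) => [x x0|t /nNA//].
  by rewrite QfE bfMN oppr_ge0 leNgt; apply/negP => ?; apply: nex; exists x.
have seg p q : Qf B p = 0 -> Qf B q = 0 -> bf B p q = 0 -> 0 < Qf A p -> Qf A q < 0 ->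
    exists y, [/\ Qf A y = 0, Qf B y = 0 & A *m y != 0 \/ B *m y != 0].
  move=> p0 q0 pq Ap Aq.
  have [y [? ? ?]] := isotropic_plane_zero sA sB p0 q0 pq Ap Aq.
  by exists y; split=> //; left.
have [pm0|pm0] := eqVneq (bf B xpos xneg) 0; first exact: (seg xpos xneg).
have [z [z0 o1 o2 zn]] := isotropic_orthogonal sB pB nB xp_0 pm0.
have [zm|zp|ze] := ltgtP (Qf A z) 0; first exact: (seg xpos z).
- by apply: (seg z xneg) => //; rewrite bfC.
- by exists z; split=> //; right.
Qed.

(** Dual vectors encode the linear independence of [A *m y] and [B *m y], that is, of the gradients
    at [y]. *)
Definition regular_at A B y := exists u1 u2,
  [/\ bf A y u1 = 1, bf B y u1 = 0, bf A y u2 = 0 & bf B y u2 = 1].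

Lemma regular_swap A B y : regular_at A B y -> regular_at B A y.
Proof. by case=> u1 [u2 [? ? ? ?]]; exists u2, u1. Qed.

Lemma regular_shift A B y k : regular_at A B y -> regular_at A (B + k *: A) y.
Proof.
case=> u1 [u2 [e1 e2 e3 e4]]; exists (u1 - k *: u2), u2.
by rewrite !bfE e1 e2 e3 e4; split; ring.
Qed.

(** Gram-Schmidt: [r] is the component of [B *m y] orthogonal to [A *m y]. *)
Lemma regular_or_proportional A B y : symmx A -> symmx B -> A *m y != 0 ->
  regular_at A B y \/ exists s, (B - s *: A) *m y = 0.
Proof.
move=> sA sB f0.
have dot0 (f : 'cV[R]_n) : f != 0 -> dot f f != 0 by apply: contraNneq => /dot_eq0 ->.
pose f := A *m y; pose g := B *m y.
have fE v : bf A y v = dot f v by rewrite bf_dotl.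
have gE v : bf B y v = dot g v by rewrite bf_dotl.
have ff := dot0 _ f0; rewrite -/f in ff.
pose s := dot f g / dot f f; pose r := g + (- s) *: f.
have [r0|rn] := eqVneq r 0.
  by right; exists s; rewrite mulmxBl -scalemxAl -/f -/g -r0 /r scaleNr.
left; have rr := dot0 _ rn.
have fr : dot f r = 0 by rewrite /r dotDr dotZr /s; field.
have gr : dot g r = dot r r.
  have -> : dot r r = dot r g + - s * dot r f by rewrite -dotZr -dotDr.
  by rewrite (dotC r f) fr mulr0 addr0 dotC.
exists ((dot f f)^-1 *: f + (- s / dot r r) *: r), ((dot r r)^-1 *: r).
clearbody r; rewrite !fE !gE !dotDr !dotZr fr gr (dotC g f); split.
- by field; apply/andP.
- by rewrite /s; field; apply/andP.
- by rewrite mulr0.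
- by field.
Qed.

(** As [y] lies in the kernel of [N], any plane through [y] and an [N]-isotropic vector is
    [N]-isotropic; a second zero of [Qf A] in such a plane is regular. *)
Lemma regular_step A N y : symmx A -> symmx N -> indef N ->
  N *m y = 0 -> Qf A y = 0 -> A *m y != 0 ->
  exists x, [/\ Qf A x = 0, Qf N x = 0 & regular_at A N x].
Proof.
move=> sA sN [[p p0] [w w0]] Ny Ay0 Ayn.
have [p1 [p10 yp]] : exists p1, 0 < Qf N p1 /\ bf A y p1 != 0.
  have [yp|] := eqVneq (bf A y p) 0; last by exists p.
  have [d d0 h] := near0_exists (near0_quad_gt0 (2 * bf N p (A *m y)) (Qf N (A *m y)) p0).
  exists (p + d *: (A *m y)); split.
    by rewrite QfDZ //; apply: h; rewrite gtr0_norm.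
  rewrite !bfE yp add0r; apply: mulf_neq0; first by rewrite gt_eqF.
  by rewrite bf_dotl //; apply: contraNneq Ayn => /dot_eq0 ->.
have [t1 [t2 [/andP[t10 t20] e1 e2]]] := isotropic_on_line sN p10 w0.
(* Since [bf A y p1] is nonzero, at most one of the two isotropic points on the line is orthogonal
   to [y]. *)
have [v [v0 Nv yv]] : exists v, [/\ Qf N v = 0, N *m v != 0 & bf A y v != 0].
  have [h1|h1] := eqVneq (bf A y (w + t1 *: p1)) 0; last first.
    by exists (w + t1 *: p1); split=> //; apply: isotropic_on_line_nker.
  exists (w + t2 *: p1); split=> //; first exact: isotropic_on_line_nker.
  have -> : bf A y (w + t2 *: p1) = (t2 - t1) * bf A y p1.
    by move: h1; rewrite !bfE; lra.
  by rewrite mulf_neq0 // gt_eqF; lra.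
have Nyz z : bf N y z = 0 by apply: ker_bf.
(* Besides [y], this is the other [A]-isotropic direction in the plane of [y] and [v]. *)
pose x := Qf A v *: y + (- 2 * bf A y v) *: v.
pose z := N *m v.
have vz : bf N v z != 0 by rewrite bf_dotl //; apply: contraNneq Nv => /dot_eq0 ->.
exists x; split.
- by rewrite /x QfE !bfE (bfC v y) // -!QfE Ay0; ring.
- by rewrite /x QfE !bfE (bfC v y) // !Nyz -!QfE v0; ring.
pose al := bf A x y; pose be := bf N x z.
have alE : al = - 2 * bf A y v ^+ 2.
  by rewrite /al /x !bfE -!QfE Ay0 (bfC v y) //; ring.
have al0 : al != 0 by rewrite alE mulf_neq0 ?expf_neq0 // oppr_eq0 pnatr_eq0.
have beE : be = - 2 * bf A y v * bf N v z by rewrite /be /x !bfE Nyz; ring.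
have be0 : be != 0 by rewrite beE !mulf_neq0 // oppr_eq0 pnatr_eq0.
have xy : bf N x y = 0 by rewrite (bfC x y).
exists (al^-1 *: y), (be^-1 *: (z - (bf A x z / al) *: y)).
clear alE beE; clearbody x; rewrite !bfE -/al -/be xy; split.
- by rewrite mulVf.
- by rewrite mulr0.
- by rewrite divfK // subrr mulr0.
- by rewrite mulr0 subr0 mulVf.
Qed.

Lemma pencil_regular_zero A B y : symmx A -> symmx B ->
  (forall s, indef (B + s *: A)) -> (forall s, indef (A + s *: B)) ->
  Qf A y = 0 -> Qf B y = 0 -> A *m y != 0 \/ B *m y != 0 ->
  exists x, [/\ Qf A x = 0, Qf B x = 0 & regular_at A B x].
Proof.
have step A' B' : symmx A' -> symmx B' -> (forall s, indef (B' + s *: A')) ->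
  Qf A' y = 0 -> Qf B' y = 0 -> A' *m y != 0 ->
  exists x, [/\ Qf A' x = 0, Qf B' x = 0 & regular_at A' B' x].
  move=> sA sB iB yA yB yn.
  have [ry|[s Ny]] := regular_or_proportional sA sB yn; first by exists y.
  have [||x [xA xN rx]] := @regular_step A' (B' - s *: A') y sA _ _ Ny yA yn.
  - by apply: symmxD => //; apply: symmxN; apply: symmxZ.
  - by rewrite -scaleNr; apply: iB.
  exists x; split=> //; first by move: xN; rewrite QfE !bfE -!QfE xA; lra.
  by have := regular_shift s rx; rewrite subrK.
move=> sA sB iB iA yA yB [yn|yn]; first exact: step.
have [x [? ? ?]] := step B A sB sA iA yB yA yn.
by exists x; split=> //; apply: regular_swap.
Qed.

End PencilZero.

(** * Forms vanishing on the common zeros *)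

Section BoundedOn.
Variables (R : realType) (rho : R).

Definition bounded_on (f : R -> R) := exists K, forall r, `|r| <= rho -> `|f r| <= K.

Lemma bounded_cst k : bounded_on (fun=> k).
Proof. by exists `|k|. Qed.

Lemma bounded_id : bounded_on id.
Proof. by exists rho. Qed.

Lemma boundedD f g : bounded_on f -> bounded_on g -> bounded_on (fun r => f r + g r).
Proof.
move=> [K hf] [L hg]; exists (K + L) => r hr.
by apply: le_trans (ler_normD _ _) _; apply: lerD; [apply: hf | apply: hg].
Qed.

Lemma boundedM f g : bounded_on f -> bounded_on g -> bounded_on (fun r => f r * g r).
Proof.
move=> [K hf] [L hg]; exists (K * L) => r hr.
by rewrite normrM; apply: ler_pM => //; [apply: hf | apply: hg].
Qed.

Lemma boundedN f : bounded_on f -> bounded_on (fun r => - f r).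
Proof. by case=> K hf; exists K => r hr; rewrite normrN; apply: hf. Qed.

Lemma bounded_ext f g : f =1 g -> bounded_on f -> bounded_on g.
Proof. by move=> e [K h]; exists K => r; rewrite -e; apply: h. Qed.

Lemma bounded_bf n (M : 'M[R]_n) x u v : bounded_on (fun r => bf M x (u + r *: v)).
Proof.
apply: (@bounded_ext (fun r => bf M x u + r * bf M x v)).
  by move=> r; rewrite !bfE.
by apply/boundedD/boundedM/bounded_cst/bounded_id/bounded_cst.
Qed.

Lemma bounded_Qf n (M : 'M[R]_n) u v : symmx M -> bounded_on (fun r => Qf M (u + r *: v)).
Proof.
move=> sM; apply: (@bounded_ext (fun r => Qf M u + 2 * bf M u v * r + Qf M v * (r * r))).
  by move=> r; rewrite QfDZ.
apply: boundedD; first apply: boundedD; first exact: bounded_cst.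
  by apply/boundedM/bounded_id/bounded_cst.
by apply/boundedM; [exact: bounded_cst | apply: boundedM; exact: bounded_id].
Qed.

Lemma cubic_pos_bounded k0 k1 k2 k3 : 0 < k0 -> 0 <= rho ->
  bounded_on k1 -> bounded_on k2 -> bounded_on k3 ->
  \forall t \near (0 : R), forall r, `|r| <= rho ->
    0 < k0 + k1 r * t + k2 r * t ^+ 2 + k3 r * t ^+ 3.
Proof.
move=> k00 rho0 [K1 h1] [K2 h2] [K3 h3].
have n0 : `|0 : R| <= rho by rewrite normr0.
have K10 := le_trans (normr_ge0 _) (h1 _ n0).
have K20 := le_trans (normr_ge0 _) (h2 _ n0).
have K30 := le_trans (normr_ge0 _) (h3 _ n0).
have [|d /andP[d0 _] h] := @cubic_pos_uniform R k0 (K1 + K2 + K3) k00; first lra.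
apply: (near0_intro d0) => t ht r hr; apply: h => //.
- by have := h1 r hr; lra.
- by have := h2 r hr; lra.
- by have := h3 r hr; lra.
Qed.

End BoundedOn.

Lemma cubic_ivt (R : realType) (k0 k1 k2 k3 a b : R) (f : R -> R) :
  (forall r, f r = k0 + k1 * r + k2 * r ^+ 2 + k3 * r ^+ 3) ->
  a <= b -> f a <= 0 -> 0 <= f b -> exists2 r, a <= r <= b & f r = 0.
Proof.
move=> fE ab fa fb; pose P : {poly R} := k0%:P + k1 *: 'X + k2 *: 'X^2 + k3 *: 'X^3.
have PE r : P.[r] = f r.
  by rewrite /P !hornerD !hornerZ !hornerXn hornerX hornerC fE.
have [|r hr] := @poly_ivt R P a b ab; first by rewrite !PE fa fb.
by rewrite rootE PE => /eqP fr; exists r.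
Qed.

(** * Projection from a regular common zero *)

Section RegularPoint.
Variables (R : realType) (n : nat) (A B : 'M[R]_n) (y u1 u2 : 'cV[R]_n).
Hypotheses (sA : symmx A) (sB : symmx B) (yA : Qf A y = 0) (yB : Qf B y = 0).
Hypotheses (a1 : bf A y u1 = 1) (b1 : bf B y u1 = 0)
           (a2 : bf A y u2 = 0) (b2 : bf B y u2 = 1).
Implicit Types (C : 'M[R]_n) (v e h z : 'cV[R]_n) (s t : R).

Definition vanishes_on_zeros C := forall x, Qf A x = 0 -> Qf B x = 0 -> Qf C x = 0.

(* The projection of the common zero set from [y] is the cubic cone
   [bf A y v * Qf B v = bf B y v * Qf A v]. *)
Lemma project_from_zero C v : symmx C -> vanishes_on_zeros C ->
  bf A y v != 0 -> bf A y v * Qf B v = bf B y v * Qf A v ->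
  bf A y v * Qf C v = bf C y v * Qf A v.
Proof.
(* [x] is the other [A]-isotropic direction in the plane of [y] and [v]; by [G] it is also
   [B]-isotropic. *)
move=> sC vC av G; pose x := Qf A v *: y + (- 2 * bf A y v) *: v.
have QE M : symmx M -> Qf M y = 0 -> Qf M x =
    4 * bf A y v * (bf A y v * Qf M v - bf M y v * Qf A v).
  move=> sM yM; rewrite QfDZ // QfE !bfE -!QfE yM; ring.
have xA : Qf A x = 0 by rewrite QE //; ring.
have xB : Qf B x = 0 by rewrite QE // G subrr mulr0.
have := vC x xA xB; rewrite QE //; last exact: vC.
move=> /eqP; rewrite mulf_eq0 mulf_eq0 (negbTE av) pnatr_eq0 /= subr_eq0.
by move/eqP.
Qed.

(** At [z + t *: (u1 + r *: u2)] the functionals of [A] and [B] at [y] are [t] and [t * r], so the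
    cubic cone reads [Qf B = r * Qf A]. It is solved with [r] near [r0] for small [t], and there the
    projection identity makes [bf C y] of order [t]. *)
Lemma tangent_vanish C z : symmx C -> vanishes_on_zeros C ->
  bf A y z = 0 -> bf B y z = 0 -> Qf A z != 0 -> bf C y z = 0.
Proof.
move=> sC vC az bz qz; apply/eqP; apply: contraT => cz.
set q := Qf A z in qz; pose r0 := Qf B z / q; pose S r := u1 + r *: u2.
have q2 : 0 < q ^+ 2 by rewrite exprn_even_gt0.
have rz : Qf B z = r0 * q by rewrite /r0 divfK.
have phiE r t : q * (Qf B (z + t *: S r) - r * Qf A (z + t *: S r)) =
   q ^+ 2 * (r0 - r) + q * (2 * bf B z (S r) - r * (2 * bf A z (S r))) * t +
   q * (Qf B (S r) - r * Qf A (S r)) * t ^+ 2.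
  by rewrite !QfDZ // rz -/q; ring.
pose phi1 r := q * (2 * bf B z (S r) - r * (2 * bf A z (S r))).
pose phi2 r := q * (Qf B (S r) - r * Qf A (S r)).
have h1 : \forall t \near (0 : R), 0 < q * (Qf B (z + t *: S (r0 - 1)) - (r0 - 1) * Qf A (z + t *: S (r0 - 1))).
  apply: filterS (near0_quad_gt0 (phi1 (r0 - 1)) (phi2 (r0 - 1)) q2) => t.
  by rewrite phiE subKr mulr1.
have h2 : \forall t \near (0 : R), 0 < - (q * (Qf B (z + t *: S (r0 + 1)) - (r0 + 1) * Qf A (z + t *: S (r0 + 1)))).
  apply: filterS (near0_quad_gt0 (- phi1 (r0 + 1)) (- phi2 (r0 + 1)) q2) => t.
  by rewrite phiE -/(phi1 _) -/(phi2 _); lra.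
pose k := q * bf C y z; have k2 : 0 < k ^+ 2.
  by rewrite exprn_even_gt0 //= mulf_neq0.
(* Uniform in [r], because the intermediate value theorem supplies an [r] that depends on [t]. The
   factor [k] makes the constant term a square. *)
have h3 : \forall t \near (0 : R), forall r, `|r| <= `|r0| + 1 ->
    0 < k * (Qf A (z + t *: S r) * bf C y (z + t *: S r) - t * Qf C (z + t *: S r)).
  pose c0 := bf C y z.
  pose k1 r := k * (q * bf C y (S r) + (2 * bf A z (S r)) * c0 - Qf C z).
  pose k2' r := k * ((2 * bf A z (S r)) * bf C y (S r) + Qf A (S r) * c0 - 2 * bf C z (S r)).
  pose k3 r := k * (Qf A (S r) * bf C y (S r) - Qf C (S r)).
  have bC := @bounded_cst R (`|r0| + 1).
  have B1 M x : bounded_on (`|r0| + 1) (fun r => bf M x (S r)) by apply: bounded_bf.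
  have B2 M : symmx M -> bounded_on (`|r0| + 1) (fun r => Qf M (S r)) by apply: bounded_Qf.
  apply: filterS (@cubic_pos_bounded R (`|r0| + 1) (k ^+ 2) k1 k2' k3 k2 _ _ _ _).
  - move=> t ht r hr; have := ht r hr; rewrite (QfDZ z (S r) t sA) (QfDZ z (S r) t sC) (bfDr C y z (t *: S r)) bfZr.
    by rewrite -/q -/c0 /k1 /k2' /k3 /k -/c0; congr (_ < _); ring.
  - by have := normr_ge0 r0; lra.
  - exact (boundedM (bC k) (boundedD (boundedD (boundedM (bC q) (B1 C y))
      (boundedM (boundedM (bC 2) (B1 A z)) (bC c0))) (boundedN (bC (Qf C z))))).
  - exact (boundedM (bC k) (boundedD (boundedD (boundedM (boundedM (bC 2) (B1 A z)) (B1 C y))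
      (boundedM (B2 A sA) (bC c0))) (boundedN (boundedM (bC 2) (B1 C z))))).
  - exact (boundedM (bC k) (boundedD (boundedM (B2 A sA) (B1 C y)) (boundedN (B2 C sC)))).
have [d d0 H] := near0_exists (filterI (filterI h1 h2) h3).
have [|[p1 p2] p3] := H d; first by rewrite gtr0_norm.
pose z1 := z + d *: u1.
have [||||r /andP[rl rr] phi0] := @cubic_ivt R
   (- q * Qf B z1) (- q * (2 * bf B z1 u2 * d - Qf A z1))
   (- q * (Qf B u2 * d ^+ 2 - 2 * bf A z1 u2 * d)) (q * Qf A u2 * d ^+ 2) (r0 - 1) (r0 + 1)
   (fun r => - (q * (Qf B (z + d *: S r) - r * Qf A (z + d *: S r)))).
- move=> r; have -> : z + d *: S r = z1 + (d * r) *: u2.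
    by rewrite /S /z1 scalerDr scalerA addrA.
  by rewrite !QfDZ //; ring.
- by lra.
- by rewrite oppr_le0 ltW.
- exact: ltW.
have {}phi0 : Qf B (z + d *: S r) = r * Qf A (z + d *: S r).
  by apply/eqP; move/eqP: phi0; rewrite oppr_eq0 mulf_eq0 (negbTE qz) /= subr_eq0.
have aE : bf A y (z + d *: S r) = d by rewrite !bfE az a1 a2; ring.
have bE : bf B y (z + d *: S r) = d * r by rewrite !bfE bz b1 b2; ring.
have := @project_from_zero C (z + d *: S r) sC vC; rewrite aE bE gt_eqF //= phi0 mulrA.
move=> /(_ isT erefl) e.
have := p3 r; rewrite e (mulrC (bf C y _)) subrr mulr0 ltxx => P3; apply: P3.
by rewrite ler_norml; have := ler_norm r0; have := ler_norm (- r0); rewrite normrN; lra.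
Qed.

(** For [h] tangent at [y], [tangent_vanish] applies to [e + t *: h] for all small [t], hence
    [bf C y h = 0]. The dual vectors then give the coefficients. *)
Lemma gradient_span C e : symmx C -> vanishes_on_zeros C ->
  bf A y e = 0 -> bf B y e = 0 -> Qf A e != 0 ->
  exists l m, forall v, bf C y v = l * bf A y v + m * bf B y v.
Proof.
move=> sC vC ae be qe.
have cT h : bf A y h = 0 -> bf B y h = 0 -> bf C y h = 0.
  move=> ah bh; suff : \forall t \near (0 : R), bf C y e + bf C y h * t + 0 * t ^+ 2 = 0.
    by case/near0_quad_eq0.
  have q2 : 0 < Qf A e ^+ 2 by rewrite exprn_even_gt0.
  apply: filterS (near0_quad_gt0 (Qf A e * (2 * bf A e h)) (Qf A e * Qf A h) q2) => t ht.
  have := @tangent_vanish C (e + t *: h) sC vC; rewrite !bfE ae be ah bh.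
  rewrite !mulr0 !addr0 => H; rewrite mul0r addr0 -[RHS]H //; first by rewrite mulrC.
  apply: contraTneq ht; rewrite QfDZ // => E; rewrite -leNgt.
  have -> : Qf A e ^+ 2 + Qf A e * (2 * bf A e h) * t + Qf A e * Qf A h * t ^+ 2 =
     Qf A e * (Qf A e + 2 * bf A e h * t + Qf A h * t ^+ 2) by ring.
  by rewrite E mulr0.
exists (bf C y u1), (bf C y u2) => v.
have := cT (v - bf A y v *: u1 - bf B y v *: u2); rewrite !bfE a1 a2 b1 b2.
by move=> /(_ _ _) H; have {}H := H ltac:(ring) ltac:(ring); lra.
Qed.

(** Proportionality on the hyperplanes of a pencil is assembled into one cubic identity. Unless
    [C = 0], it makes some [B + s *: A] vanish on a hyperplane, against the rank bound. *)
Lemma vanishing_form_eq0 C e : symmx C -> vanishes_on_zeros C ->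
  (forall v, bf C y v = 0) ->
  bf A y e = 0 -> bf B y e = 0 -> Qf A e != 0 -> Qf B e != 0 ->
  pos2 B -> pos2 (- B) -> (forall s, (2 < \rank (B + s *: A)%R)%N) -> C = 0.
Proof.
move=> sC vC cy ae be qA qB pB nB rk.
have sN s : symmx (B + s *: A) by apply: symmxD => //; apply: symmxZ.
(* The proportionality factor on the hyperplane is found by evaluation at [e], which lies in all
   these hyperplanes. *)
have key : \forall s \near (0 : R), forall v, bf B y v + s * bf A y v = 0 ->
    (Qf B e + s * Qf A e) * Qf C v = Qf C e * (Qf B v + s * Qf A v).
  have h3 : \forall s \near (0 : R), Qf B e + s * Qf A e != 0.
    have q2 : 0 < Qf B e ^+ 2 by rewrite exprn_even_gt0.
    apply: filterS (near0_quad_gt0 (Qf B e * Qf A e) 0 q2) => s hs.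
    apply: contraTneq hs => E; rewrite -leNgt.
    have -> : Qf B e ^+ 2 + Qf B e * Qf A e * s + 0 * s ^+ 2 =
       Qf B e * (Qf B e + s * Qf A e) by ring.
    by rewrite E mulr0.
  apply: filterS3 (pos2_near A pB) (pos2_near (- A) nB) h3 => s ps ns es.
  have NE v : Qf (B + s *: A) v = Qf B v + s * Qf A v by rewrite QfE !bfE.
  have NbE v : bf (B + s *: A) y v = bf B y v + s * bf A y v by rewrite !bfE.
  rewrite scalerN -opprD in ns.
  have [p [p0 yp]] := pos2_hyperplane y (sN s) ps.
  have [w [w0 yw]] := pos2_hyperplane y (symmxN (sN s)) ns.
  rewrite QfE bfMN -QfE oppr_gt0 in w0; rewrite bfMN in yw.
  move/eqP: yw; rewrite oppr_eq0 => /eqP yw.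
  have [|||||||k hk] := @form_proportional R n (fun v => bf (B + s *: A) y v = 0) (bf A y)
    (B + s *: A) C _ _ (sN s) sC _ p w e (u1 - s *: u2) yp yw _ _ p0 w0 ae.
  - by move=> x1 x2 t h1 h2; rewrite bfDr bfZr h1 h2 mulr0 addr0.
  - by move=> x1 x2 t; rewrite bfDr bfZr.
  - move=> x; rewrite NbE NE => bx Qx ax; have := @project_from_zero C x sC vC ax.
    rewrite cy mul0r => H; have {}H : bf A y x * Qf C x = 0.
      apply: H; have -> : bf B y x = - (s * bf A y x) by lra.
      have -> : Qf B x = - (s * Qf A x) by lra.
      ring.
    by move/eqP: H; rewrite mulf_eq0 (negbTE ax) => /eqP.
  - by rewrite NbE ae be; ring.
  - by rewrite NbE !bfE a1 a2 b1 b2; ring.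
  - by rewrite NE.
  - by rewrite !bfE a1 a2 mulr0 subr0 oner_neq0.
  move=> v hv; have := hk v; rewrite NbE NE => /(_ hv) ->.
  have := hk e; rewrite NbE NE ae be mulr0 addr0 => /(_ erefl) ->; ring.
(* Near [u1] the parameter [s = - bf B y / bf A y] is small, so [key] applies at [u1 + t *: h]. The
   coefficient of [t ^+ 3] is the identity at [h]. *)
have cub h : (bf A y h * Qf B e - bf B y h * Qf A e) * Qf C h =
             Qf C e * (bf A y h * Qf B h - bf B y h * Qf A h).
  have [d d0 hd] := near0_exists key.
  have hcone : \forall t \near (0 : R), (1 + bf A y h * t) * Qf B e * Qf C (u1 + t *: h) -
     (bf B y h * t) * Qf A e * Qf C (u1 + t *: h) -
     Qf C e * ((1 + bf A y h * t) * Qf B (u1 + t *: h) - bf B y h * t * Qf A (u1 + t *: h)) = 0.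
    have g1 := near0_quad_gt0 (bf A y h) 0 (ltr01 : 0 < 1 :> R).
    have g2 := near0_quad_gt0 (d * bf A y h - bf B y h) 0 d0.
    have g3 := near0_quad_gt0 (d * bf A y h + bf B y h) 0 d0.
    apply: filterS3 g1 g2 g3 => t g1 g2 g3.
    set a := 1 + bf A y h * t; set b := bf B y h * t.
    have a0 : 0 < a by rewrite /a; lra.
    have an : a != 0 by rewrite gt_eqF.
    have := hd (- b / a); rewrite normrM normrN normfV (gtr0_norm a0) ler_pdivrMr //.
    have bd : `|b| <= d * a by rewrite ler_norml /a /b; apply/andP; split; lra.
    move=> /(_ bd (u1 + t *: h)); rewrite !bfE a1 b1.
    have -> : 0 + t * bf B y h = b by rewrite /b; ring.
    have -> : 1 + t * bf A y h = a by rewrite /a; ring.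
    move=> H; have {}H := H ltac:(field; exact: an).
    have {H} := congr1 (fun x => a * x) H.
    set c := Qf C _; set qb := Qf B (u1 + _); set qa := Qf A (u1 + _).
    have -> : a * ((Qf B e + - b / a * Qf A e) * c) = (a * Qf B e - b * Qf A e) * c by field.
    have -> : a * (Qf C e * (qb + - b / a * qa)) = Qf C e * (a * qb - b * qa) by field.
    lra.
  pose al := bf A y h; pose be' := bf B y h.
  have := @near0_cubic_eq0 R
    (Qf B e * Qf C u1 - Qf C e * Qf B u1)
    (al * Qf B e * Qf C u1 + Qf B e * (2 * bf C u1 h) - be' * Qf A e * Qf C u1
      - Qf C e * (al * Qf B u1 + 2 * bf B u1 h - be' * Qf A u1))
    (al * Qf B e * (2 * bf C u1 h) + Qf B e * Qf C h - be' * Qf A e * (2 * bf C u1 h)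
      - Qf C e * (al * (2 * bf B u1 h) + Qf B h - be' * (2 * bf A u1 h)))
    ((al * Qf B e - be' * Qf A e) * Qf C h - Qf C e * (al * Qf B h - be' * Qf A h)).
  case=> [|_ _ _ /eqP]; last by rewrite subr_eq0 => /eqP.
  apply: filterS hcone => t ht; rewrite -[RHS]ht !QfDZ // -/al -/be'; ring.
(* If [Qf C e = 0], the linear factor in [cub] is nonzero near [u1], where its value is [Qf B e];
   thus [Qf C] vanishes near [u1], hence everywhere. *)
have [ce0|ce] := eqVneq (Qf C e) 0.
  apply: Qf_eq0_mx => // h.
  suff : \forall t \near (0 : R), Qf C u1 + 2 * bf C u1 h * t + Qf C h * t ^+ 2 = 0.
    by case/near0_quad_eq0.
  have q2 : 0 < Qf B e ^+ 2 by rewrite exprn_even_gt0.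
  apply: filterS (near0_quad_gt0
    (Qf B e * (bf A y h * Qf B e - bf B y h * Qf A e)) 0 q2) => t ht.
  have := cub (u1 + t *: h); rewrite ce0 mul0r => /eqP; rewrite mulf_eq0 QfDZ //.
  case/orP => /eqP // E; move: ht.
  have -> : Qf B e ^+ 2 + Qf B e * (bf A y h * Qf B e - bf B y h * Qf A e) * t + 0 * t ^+ 2 =
    Qf B e * (bf A y (u1 + t *: h) * Qf B e - bf B y (u1 + t *: h) * Qf A e).
    by rewrite !bfE a1 b1; ring.
  by rewrite E mulr0 ltxx.
(* This [s] makes [Qf N e = 0], so the linear factor in [cub] vanishes on the hyperplane
   [bf N y = 0]. *)
pose s := - (Qf B e / Qf A e); pose N := B + s *: A.
have sE : Qf B e = - (s * Qf A e) by rewrite /s mulNr opprK divfK.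
have aN v : bf N y v = 0 -> bf A y v * Qf N v = 0.
  rewrite /N QfE !bfE -!QfE => bv; have bvE : bf B y v = - (s * bf A y v) by lra.
  have := cub v; rewrite bvE sE => H.
  apply: (mulfI ce); rewrite mulr0; transitivity
   ((bf A y v * - (s * Qf A e) - - (s * bf A y v) * Qf A e) * Qf C v); last by ring.
  by rewrite H; ring.
suff : (\rank N <= 1 + 1)%N by rewrite leqNgt rk.
apply: (@rank_vanishing_form _ _ _ (y^T *m N) _ (sN s)) => v hv.
have {}hv : bf N y v = 0 by rewrite /bf hv mxE.
(* Points with [bf A y v = 0] are reached by moving inside the hyperplane along [g], where
   [bf A y g = 1]. *)
have [av|av] := eqVneq (bf A y v) 0; last first.
  by have /eqP := aN v hv; rewrite mulf_eq0 (negbTE av) => /eqP.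
have gN : bf N y (u1 - s *: u2) = 0 by rewrite /N !bfE a1 a2 b1 b2; ring.
pose g := u1 - s *: u2.
have := @near0_cubic_eq0 R 0 (Qf N v) (2 * bf N v g) (Qf N g).
case=> //; apply: filterE => t.
have := aN (v + t *: g); rewrite bfDr bfZr hv gN mulr0 addr0 => /(_ erefl).
rewrite bfDr bfZr av QfDZ; last exact: sN.
have -> : bf A y g = 1 by rewrite /g !bfE a1 a2; ring.
by move=> E; rewrite -[RHS]E; ring.
Qed.

Lemma vanishing_form_span C e : symmx C -> vanishes_on_zeros C ->
  bf A y e = 0 -> bf B y e = 0 -> Qf A e != 0 -> Qf B e != 0 ->
  pos2 B -> pos2 (- B) -> (forall s, (2 < \rank (B + s *: A)%R)%N) ->
  exists l m, C = l *: A + m *: B.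
Proof.
move=> sC vC ae be qA qB pB nB rk.
have [l [m cE]] := gradient_span sC vC ae be qA.
exists l, m; apply/eqP; rewrite -subr_eq0; apply/eqP.
apply: (@vanishing_form_eq0 _ e) => //.
- apply: symmxD => //; apply: symmxN; apply: symmxD; exact: symmxZ.
- by move=> x xA xB; rewrite QfE !bfE -!QfE xA xB vC //; ring.
- by move=> v; rewrite !bfE cE; ring.
Qed.

End RegularPoint.

(** * Pencils of minimal rank at least three *)

Section GenericPencil.
Variables (R : realType) (n : nat).
Implicit Types (A B C M : 'M[R]_n).

Lemma indef_not_psd M : indef M -> ~ psd M.
Proof. by case=> _ [w w0] /(_ w); rewrite leNgt w0. Qed.

(** A form vanishing on a subspace of codimension at most 2 has rank at most 4. *)
Lemma rank5_nonvanishing M (r1 r2 : 'rV[R]_n) : symmx M -> (4 < \rank M)%N ->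
  exists e : 'cV[R]_n, [/\ (r1 *m e) 0 0 = 0, (r2 *m e) 0 0 = 0 & Qf M e != 0].
Proof.
move=> sM rM; apply: contrapT => nex.
suff : (\rank M <= (1 + 1) + (1 + 1))%N by rewrite leqNgt rM.
apply: (@rank_vanishing_form _ _ _ (col_mx r1 r2)) => // x.
rewrite mul_col_mx => /eqP; rewrite col_mx_eq0 => /andP[/eqP h1 /eqP h2].
apply/eqP; apply: contraT => qx; case: nex; exists x.
by rewrite h1 h2 mxE; split.
Qed.

(** The work is a choice of basis of the pencil that meets the conditions of [vanishing_form_span];
    the conclusion is then carried back to [A] and [B]. *)
Lemma pencil_vanishing_span A B C : symmx A -> symmx B -> symmx C ->
  (forall s t, (s != 0) || (t != 0) -> indef (s *: A + t *: B)) ->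
  (forall s t, (s != 0) || (t != 0) -> (2 < \rank (s *: A + t *: B)%R)%N) ->
  (exists s t, (4 < \rank (s *: A + t *: B)%R)%N) ->
  vanishes_on_zeros A B C -> exists l m, C = l *: A + m *: B.
Proof.
move=> sA sB sC hi hr [s5 [t5 r5]] vC.
have iA : indef A by have := hi 1 0; rewrite scale1r scale0r addr0 oner_neq0; apply.
have rA : (2 < \rank A)%N by have := hr 1 0; rewrite scale1r scale0r addr0 oner_neq0; apply.
have iB s : indef (B + s *: A).
  by have := hi s 1; rewrite scale1r addrC oner_neq0 orbT; apply.
have rB s : (2 < \rank (B + s *: A)%R)%N.
  by have := hr s 1; rewrite scale1r addrC oner_neq0 orbT; apply.
have [s1 [pB1 nB1]] := mixed_member sA sB iA rA iB rB.
set B1 := B + s1 *: A in pB1 nB1.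
have sB1 : symmx B1 by apply: symmxD => //; apply: symmxZ.
have EAB1 s t : s *: A + t *: B1 = (s + t * s1) *: A + t *: B.
  by rewrite /B1 scalerDr scalerA scalerDl -addrA (addrC (t *: B)).
have hi1 s t : (s != 0) || (t != 0) -> indef (s *: A + t *: B1).
  move=> st; rewrite EAB1; apply: hi; have [t0|] := eqVneq t 0; last by rewrite orbT.
  by move: st; rewrite t0 mul0r addr0 eqxx orbF => ->.
have iAB1 s : indef (A + s *: B1).
  by have := hi1 1 s; rewrite scale1r oner_neq0; apply.
have iNAB1 s : indef (- A + s *: B1).
  by have := hi1 (- 1) s; rewrite scaleN1r oppr_eq0 oner_neq0; apply.
have iB1A s : indef (B1 + s *: A).
  by have := hi1 s 1; rewrite scale1r addrC oner_neq0 orbT; apply.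
have [y0 [y0A y0B y0n]] : exists y, [/\ Qf A y = 0, Qf B1 y = 0 & A *m y != 0 \/ B1 *m y != 0].
  apply: pencil_zero => // t; exact: indef_not_psd.
have [y [yA yB ry]] := pencil_regular_zero sA sB1 iB1A iAB1 y0A y0B y0n.
have sM : symmx (s5 *: A + t5 *: B) by apply: symmxD; apply: symmxZ.
have [e [ae be qe]] := @rank5_nonvanishing _ (y^T *m A) (y^T *m B1) sM r5.
rewrite -/(bf A y e) -/(bf B1 y e) in ae be.
(* Both inertia conditions are open, so a small multiple of [A] makes the form nonzero at [e]
   without losing them. *)
have [s2 [pB2 nB2 qB2]] : exists s, [/\ pos2 (B1 + s *: A), pos2 (- (B1 + s *: A)) &
    Qf (B1 + s *: A) e != 0].
  have [q0|qn] := eqVneq (Qf B1 e) 0; last by exists 0; rewrite scale0r addr0.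
  have qA : Qf A e != 0.
    apply: contraNneq qe => qA; move: q0; rewrite /B1 !QfE !bfE -!QfE qA mulr0 addr0 => ->.
    by rewrite !mulr0 addr0.
  have [d d0 h] := near0_exists (filterI (pos2_near A pB1) (pos2_near (- A) nB1)).
  have [|h1 h2] := h d; first by rewrite gtr0_norm.
  exists d; split=> //; first by rewrite opprD -scalerN.
  by rewrite QfE bfMD bfMZ -!QfE q0 add0r mulf_neq0 // gt_eqF.
set B2 := B1 + s2 *: A in pB2 nB2 qB2.
have sB2 : symmx B2 by apply: symmxD => //; apply: symmxZ.
have [k qA2] : exists k, Qf (A + k *: B2) e != 0.
  have [q0|qn] := eqVneq (Qf A e) 0; last by exists 0; rewrite scale0r addr0.
  by exists 1; rewrite QfE bfMD bfMZ -!QfE q0 add0r mul1r.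
have [u1 [u2 [a1 b1 a2 b2]]] :
    regular_at (A + k *: B2) B2 y by apply/regular_swap/regular_shift/regular_swap/regular_shift.
have sA2 : symmx (A + k *: B2) by apply: symmxD => //; apply: symmxZ.
have y2 : Qf B2 y = 0 by rewrite /B2 QfE bfMD bfMZ -!QfE yA yB mulr0 addr0.
have be2 : bf B2 y e = 0 by rewrite /B2 bfMD bfMZ ae be mulr0 addr0.
have zeros x : Qf (A + k *: B2) x = 0 -> Qf B2 x = 0 -> Qf A x = 0 /\ Qf B x = 0.
  move=> hA hB; have qA : Qf A x = 0.
    by move: hA; rewrite QfE bfMD bfMZ -!QfE hB mulr0 addr0.
  by split=> //; move: hB; rewrite /B2 /B1 QfE !bfE -!QfE qA !mulr0 !addr0.
have [||||l [m ->]] := @vanishing_form_span R n (A + k *: B2) B2 y u1 u2 sA2 sB2 _ y2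
    a1 b1 a2 b2 C e sC _ _ be2 qA2 qB2 pB2 nB2.
- by rewrite QfE bfMD bfMZ -!QfE yA y2 mulr0 addr0.
- by move=> x h1 h2; have [] := zeros x h1 h2; apply: vC.
- by rewrite bfMD bfMZ ae be2 mulr0 addr0.
- move=> s; have -> : B2 + s *: (A + k *: B2) =
      (s + (1 + s * k) * (s1 + s2)) *: A + (1 + s * k) *: B.
    by apply/matrixP => i j; rewrite /B2 /B1 !mxE; ring.
  apply: hr; have [E|] := eqVneq (1 + s * k) 0; last by rewrite orbT.
  rewrite E mul0r addr0 orbF; apply: contraNneq (oner_neq0 R) => s0.
  by apply/eqP; rewrite -E s0 mul0r addr0.
exists (l + (l * k + m) * (s1 + s2)), (l * k + m).
by apply/matrixP => i j; rewrite /B2 /B1 !mxE; ring.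
Qed.

End GenericPencil.

(** * Indefinite forms of rank two *)

Section RankTwo.
Variables (R : realType).

(* [A = r1 r2^T + r2 r1^T] with [(v1, v2)] dual to [(r1, r2)] *)
Definition hyperbolic n (A : 'M[R]_n) (r1 r2 v1 v2 : 'cV[R]_n) :=
  (forall x, A *m x = dot r2 x *: r1 + dot r1 x *: r2) /\
  [/\ dot r1 v1 = 1, dot r1 v2 = 0, dot r2 v1 = 0 & dot r2 v2 = 1].

Lemma hyperbolic_swap n (A : 'M[R]_n) r1 r2 v1 v2 :
  hyperbolic A r1 r2 v1 v2 -> hyperbolic A r2 r1 v2 v1.
Proof. by case=> h [*]; split=> // x; rewrite h addrC. Qed.

Lemma hyperbolic_bf n (A : 'M[R]_n) r1 r2 v1 v2 x z : hyperbolic A r1 r2 v1 v2 ->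
  bf A x z = dot r1 x * dot r2 z + dot r2 x * dot r1 z.
Proof. by case=> h _; rewrite bf_dotr h dotDr !dotZr !(dotC x); ring. Qed.

Lemma rank2_hyperbolic n (A : 'M[R]_n) : symmx A -> indef A -> \rank A = 2%N ->
  exists r1 r2 v1 v2, hyperbolic A r1 r2 v1 v2.
Proof.
move=> sA [[p p0] [w w0]] rA.
have [t1 [t2 [/andP[t10 t20] e1 e2]]] := isotropic_on_line sA p0 w0.
pose f1 := w + t1 *: p; pose f2 := w + t2 *: p; pose g := bf A f1 f2.
(* [Qf A (f2 - f1)] equals [- 2 * g] and is a positive multiple of [Qf A p]. *)
have g0 : g != 0.
  have E : Qf A (f2 - f1) = (t2 - t1) ^+ 2 * Qf A p.
    have -> : f2 - f1 = (t2 - t1) *: p.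
      by rewrite /f1 /f2 opprD addrACA subrr add0r scalerBl.
    by rewrite QfE !bfE -QfE; ring.
  have : 0 < Qf A (f2 - f1).
    by rewrite E mulr_gt0 // exprn_even_gt0 //= subr_eq0 gt_eqF; lra.
  rewrite -scaleN1r (QfDZ f2 f1 (-1) sA) -/f1 -/f2 (bfC f2 f1) // -/g.
  rewrite (e1 : Qf A f1 = 0) (e2 : Qf A f2 = 0) => h.
  by apply: contraTneq h => ->; rewrite -leNgt; lra.
pose r1 := A *m f1; pose r2 := g^-1 *: (A *m f2).
pose v1 := g^-1 *: f2; pose v2 := f1.
have r1E x : dot r1 x = bf A f1 x by rewrite bf_dotl.
have r2E x : dot r2 x = g^-1 * bf A f2 x.
  by rewrite dotC /r2 dotZr dotC bf_dotl.
have d11 : dot r1 v1 = 1 by rewrite r1E /v1 bfZr -/g mulVf.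
have d12 : dot r1 v2 = 0 by rewrite r1E.
have d21 : dot r2 v1 = 0 by rewrite r2E /v1 bfZr -QfE e2 !mulr0.
have d22 : dot r2 v2 = 1 by rewrite r2E (bfC f2) // -/g mulVf.
have Av1 : A *m v1 = r2 by rewrite /v1 /r2 scalemxAr.
have Av2 : A *m v2 = r1 by [].
exists r1, r2, v1, v2; split=> // x.
(* [r1^T] and [r2^T] are independent in the row space of [A]; as the rank is 2 they span it, so a
   vector killed by both lies in the kernel of [A]. *)
pose K : 'M[R]_(1 + 1, n) := col_mx r1^T r2^T.
have KA : (K <= A)%MS.
  rewrite /K col_mx_sub; apply/andP; split.
    by rewrite /r1 trmx_mul sA submxMl.
  by rewrite /r2 linearZ /= trmx_mul sA scalemx_sub // submxMl.
have rK : (2 <= \rank K)%N.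
  have KV : K *m row_mx v1 v2 = 1%:M :> 'M[R]_(1 + 1).
    rewrite /K mul_col_row scalar_mx_block.
    by congr block_mx; apply/matrixP => i j; rewrite !ord1 ?[RHS]mxE.
  rewrite -[X in (X <= _)%N](mxrank1 R (1 + 1)) -KV; exact: mxrankM_maxl.
have AK : (A <= K)%MS.
  by rewrite -(geq_leqif (mxrank_leqif_sup KA)) rA.
have /submxP[D AD] := AK.
clearbody r1 r2 v1 v2; pose x' := x - dot r1 x *: v1 - dot r2 x *: v2.
have proj r : dot r x' = dot r x - dot r1 x * dot r v1 - dot r2 x * dot r v2.
  by rewrite /x' -[- (_ *: v1)]scaleNr -[- (_ *: v2)]scaleNr !dotDr !dotZr; ring.
have Ax' : A *m x' = 0.
  rewrite AD -mulmxA /K mul_col_mx.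
  have z r : dot r x' = 0 -> r^T *m x' = 0.
    by move=> h; apply/matrixP => i j; rewrite !ord1 [RHS]mxE.
  have h1 : dot r1 x' = 0 by rewrite proj d11 d12; ring.
  have h2 : dot r2 x' = 0 by rewrite proj d21 d22; ring.
  by rewrite (z _ h1) (z _ h2) col_mx0 mulmx0.
have xE : x' + dot r2 x *: v2 + dot r1 x *: v1 = x by rewrite /x' !subrK.
clearbody x'; move/(congr1 (mulmx A)): xE.
by rewrite !mulmxDr Ax' add0r -!scalemxAr Av1 Av2 => <-.
Qed.

End RankTwo.

(** * Poisson brackets and pencils of minimal rank two *)

Section Symplectic.
Variables (R : realType) (d : nat).
Implicit Types (r x z w : 'cV[R]_(d + d)) (M A B C : 'M[R]_(d + d)).

(** Up to sign, the Hamiltonian vector of the linear form [dot r]. *)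
Definition sharp r : 'cV[R]_(d + d) := col_mx (dsubmx r) (- usubmx r).

Lemma dot_split r x : dot r x =
  \sum_(j < d) (r (lshift d j) 0 * x (lshift d j) 0 + r (rshift d j) 0 * x (rshift d j) 0).
Proof.
rewrite /dot mxE big_split_ord /= -big_split /=.
by apply: eq_bigr => j _; rewrite !mxE.
Qed.

Lemma sharpl r j : sharp r (lshift d j) 0 = r (rshift d j) 0.
Proof. by rewrite /sharp col_mxEu mxE. Qed.

Lemma sharpr r j : sharp r (rshift d j) 0 = - r (lshift d j) 0.
Proof. by rewrite /sharp col_mxEd !mxE. Qed.

Lemma sigma_dot r w : sigma r w = dot (sharp r) w.
Proof. by rewrite dot_split; apply: eq_bigr => j _; rewrite sharpl sharpr; ring. Qed.

Lemma sigma_sharp r w : sigma (sharp r) w = - dot r w.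
Proof.
rewrite dot_split -sumrN; apply: eq_bigr => j _; rewrite sharpl sharpr; ring.
Qed.

Lemma sigma_comb a b x z w : sigma (a *: x + b *: z) w = a * sigma x w + b * sigma z w.
Proof.
rewrite /sigma !mulr_sumr -big_split; apply: eq_bigr => j _ /=; rewrite !mxE; ring.
Qed.

Lemma sigmaC x z : sigma x z = - sigma z x.
Proof. by rewrite /sigma -sumrN; apply: eq_bigr => j _; ring. Qed.

Lemma sigmaxx x : sigma x x = 0.
Proof. by have := sigmaC x x; lra. Qed.

Local Open Scope classical_set_scope.

Lemma derive_Qf M x z : symmx M -> 'D_x (Qf M) z = 2 * bf M x z.
Proof.
move=> sM; rewrite /derive; apply: cvg_lim => //.
have cv : (2 * bf M x z + h * Qf M x) @[h --> (0 : R)^'] --> 2 * bf M x z.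
  apply: cvg_within_filter.
  suff : (2 * bf M x z + h * Qf M x) @[h --> (0 : R)] --> 2 * bf M x z + 0 * Qf M x.
    by rewrite mul0r addr0.
  by apply: cvgD; [exact: cvg_cst | apply: cvgMl; exact: cvg_id].
apply: cvg_trans cv; apply: near_eq_cvg; near=> h.
have h0 : h != 0 by near: h; exact: nbhs_dnbhs_neq.
rewrite /= [h *: x + z]addrC (QfDZ z x h sM) (bfC z x) // /GRing.scale /=.
by field.
Unshelve. all: by end_near. Qed.

Local Close Scope classical_set_scope.

Lemma bf_delta M (i : 'I_(d + d)) z : bf M (ecoord R i) z = (M *m z) i 0.
Proof. by rewrite bf_dotr /dot /ecoord trmx_delta -rowE mxE. Qed.

(** Each gradient contributes a factor 2. *)
Lemma pbracket_Qf A B z : symmx A -> symmx B ->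
  pbracket (@Qf R _ A) (@Qf R _ B) z = 4 * sigma (A *m z) (B *m z).
Proof.
move=> sA sB; rewrite /pbracket /sigma mulr_sumr; apply: eq_bigr => j _.
by rewrite !derive_Qf // /dx /dxi !bf_delta; ring.
Qed.

Section HyperbolicPair.
Variables (A B C : 'M[R]_(d + d)) (k : R).
Hypotheses (sA : symmx A) (sB : symmx B) (sC : symmx C).
Hypothesis (CE : forall z, Qf C z = k * sigma (A *m z) (B *m z)).

Lemma hyperbolic_bracket r1 r2 v1 v2 z : hyperbolic A r1 r2 v1 v2 ->
  Qf C z = k * (dot r2 z * bf B (sharp r1) z + dot r1 z * bf B (sharp r2) z).
Proof. by move=> hA; rewrite CE hA.1 sigma_comb !sigma_dot !bf_dotr. Qed.

(** On [r1 = 0] the form [Qf A] vanishes, so [Qf C] is proportional to [Qf B]; evaluation at [e]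
    shows that the factor is 0. The bracket formula then leaves a product of two linear forms, and
    [dot r2] is not identically zero there. *)
Lemma indefinite_hyperplane r1 r2 v1 v2 p w e : hyperbolic A r1 r2 v1 v2 -> k != 0 ->
  vanishes_on_zeros A B C ->
  dot r1 p = 0 -> dot r1 w = 0 -> 0 < Qf B p -> Qf B w < 0 ->
  dot r1 e = 0 -> dot r2 e = 0 -> Qf B e != 0 ->
  exists m, forall z, bf B (sharp r1) z = m * dot r1 z.
Proof.
move=> hA k0 vC p1 w1 p0 w0 e1 e2 qe; have [_ [d11 d12 d21 d22]] := hA.
have [||||c hc] := @form_proportional R _ (fun v => dot r1 v = 0) (dot r2)
   B C _ _ sB sC _ p w e v2 p1 w1 e1 d12 p0 w0 e2 qe.
- by move=> x z t h1 h2; rewrite dotDr dotZr h1 h2 mulr0 addr0.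
- by move=> x z t; rewrite dotDr dotZr.
- move=> x x1 xB _; apply: vC => //.
  by rewrite QfE (hyperbolic_bf x x hA) x1; ring.
- by rewrite d22 oner_neq0.
have c0 : c = 0.
  have := hc e e1; rewrite (hyperbolic_bracket e hA) e1 e2 !mul0r addr0 mulr0.
  by move=> /esym /eqP; rewrite mulf_eq0 (negbTE qe) orbF => /eqP.
have van z : dot r1 z = 0 -> dot r2 z * bf B (sharp r1) z = 0.
  move=> z1; have := hc z z1; rewrite (hyperbolic_bracket z hA) c0 z1 !mul0r addr0.
  by move/eqP; rewrite mulf_eq0 (negbTE k0) => /eqP.
have m2 : bf B (sharp r1) v2 = 0 by have := van v2 d12; rewrite d22 mul1r.
have m0 z : dot r1 z = 0 -> bf B (sharp r1) z = 0.
  move=> z1; have [z2|z2] := eqVneq (dot r2 z) 0; last first.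
    by have /eqP := van z z1; rewrite mulf_eq0 (negbTE z2) => /eqP.
  have := van (z + v2); rewrite !dotDr z1 z2 d12 d22 addr0 add0r mul1r bfDr m2 addr0.
  exact.
exists (bf B (sharp r1) v1) => z.
have := m0 (z + (- dot r1 z) *: v1); rewrite dotDr dotZr d11 mulr1 subrr bfDr bfZr.
by move=> /(_ erefl); lra.
Qed.

(** If [dot r2 q] is nonzero, some [B + t *: A] has [q] in its kernel and inherits semidefiniteness
    from [r2 = 0]. Otherwise [Qf B] is affine along [v1 + s *: q] with slope [2 * m], so [m = 0] and
    [q] is in both kernels. *)
Lemma semidefinite_hyperplane r1 r2 v1 v2 m : hyperbolic A r1 r2 v1 v2 ->
  (forall z, bf B (sharp r1) z = m * dot r1 z) ->
  (forall z, dot r2 z = 0 -> 0 <= Qf B z) -> (forall t, ~ psd (B + t *: A)) ->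
  A *m sharp r1 = 0 /\ B *m sharp r1 = 0.
Proof.
move=> hA hm psd2 npsd; have [AE [d11 d12 d21 d22]] := hA.
have l1 : dot r1 (sharp r1) = 0 by rewrite dotC -sigma_dot sigmaxx.
set q := sharp r1 in hm l1 *.
have [c0|c0] := eqVneq (dot r2 q) 0; last first.
  case: (npsd (- (m / dot r2 q))) => x; set M := B + _.
  have sM : symmx M by apply: symmxD => //; apply: symmxZ.
  have Mq z : bf M q z = 0.
    by rewrite /M bfMD bfMZ hm (hyperbolic_bf q z hA) l1; field.
  have -> : x = (x + (- (dot r2 x / dot r2 q)) *: q) + (dot r2 x / dot r2 q) *: q.
    by rewrite scaleNr subrK.
  set x' := x + _; have x'2 : dot r2 x' = 0.
    by rewrite /x' dotDr dotZr; field.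
  rewrite QfDZ // (bfC x' q) // QfE (QfE M q) !Mq mulr0 !mul0r !addr0 /M bfMD bfMZ.
  by rewrite (hyperbolic_bf x' x' hA) x'2 mulr0 mul0r addr0 mulr0 addr0; apply: psd2.
have m0 : m = 0.
  apply/eqP; apply: contraT => mn.
  (* The multiple of [q] is chosen to give [Qf B] the value -1. *)
  have := psd2 (v1 + (- (Qf B v1 + 1) / (2 * m)) *: q).
  rewrite dotDr dotZr d21 c0 mulr0 addr0 => /(_ erefl).
  rewrite QfDZ // (bfC v1 q) // (QfE B q) !hm l1 d11.
  have -> : Qf B v1 + 2 * (m * 1) * (- (Qf B v1 + 1) / (2 * m)) +
    m * 0 * (- (Qf B v1 + 1) / (2 * m)) ^+ 2 = -1 by field.
  by rewrite oppr_ge0 ler10.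
split; first by rewrite AE l1 c0 !scale0r addr0.
by apply: bf_ker => // z; rewrite hm m0 mul0r.
Qed.

End HyperbolicPair.

(** The free constant [k] absorbs the change of basis that brings the rank-two member into first
    position. *)
Lemma rank2_pencil A B C k : symmx A -> symmx B -> symmx C -> indef A ->
  \rank A = 2%N -> (forall t, ~ psd (B + t *: A)) -> (forall t, ~ psd (- B + t *: A)) ->
  (exists s t, (4 < \rank (s *: A + t *: B)%R)%N) -> k != 0 ->
  (forall z, Qf C z = k * sigma (A *m z) (B *m z)) ->
  (forall z, A *m z = 0 -> B *m z = 0 ->
     (forall w, A *m w = 0 -> B *m w = 0 -> sigma z w = 0) -> z = 0) ->
  vanishes_on_zeros A B C -> exists c, C = c *: A.
Proof.
move=> sA sB sC iA rA nB nNB [s5 [t5 r5]] k0 CE ker vC.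
have [r1 [r2 [v1 [v2 hA]]]] := rank2_hyperbolic sA iA rA.
have hA' := hyperbolic_swap hA.
have sM : symmx (s5 *: A + t5 *: B) by apply: symmxD; apply: symmxZ.
have [e [e1 e2 qM]] := @rank5_nonvanishing R _ _ r1^T r2^T sM r5.
rewrite -/(dot r1 e) -/(dot r2 e) in e1 e2.
have qe : Qf B e != 0.
  apply: contraNneq qM => qB.
  rewrite QfE bfMD !bfMZ -(QfE B) qB (hyperbolic_bf e e hA) e1 e2.
  by rewrite !mul0r addr0 !mulr0 addr0.
(* [dot p] vanishes on the kernel of [A], so [sharp p] would lie in the radical of the common
   kernel, yet it is nonzero. *)
have kerF p q u v : hyperbolic A p q u v -> A *m sharp p = 0 -> B *m sharp p = 0 -> False.
  move=> [AE [d11 d12 d21 d22]] h1 h2.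
  have s0 : sharp p = 0.
    apply: ker => // w Aw _; rewrite sigma_sharp; apply/eqP; rewrite oppr_eq0; apply/eqP.
    have := congr1 (dot v) Aw; rewrite AE dotDr !dotZr (dotC v p) d12 (dotC v q) d22.
    have -> : dot v 0 = 0 by rewrite /dot mulmx0 mxE.
    by rewrite mulr0 add0r mulr1.
  have := sigma_sharp p u; rewrite s0 d11 /sigma big1 => [|j _].
    by move/esym/eqP; rewrite oppr_eq0 oner_eq0.
  by rewrite !mxE; ring.
have split_indef r : (exists p w, [/\ dot r p = 0, dot r w = 0, 0 < Qf B p & Qf B w < 0]) \/
    (forall z, dot r z = 0 -> 0 <= Qf B z) \/ (forall z, dot r z = 0 -> Qf B z <= 0).
  have [h|h] := pselect (forall z, dot r z = 0 -> 0 <= Qf B z); first by right; left.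
  have [h'|h'] := pselect (forall z, dot r z = 0 -> Qf B z <= 0); first by right; right.
  left; move/existsNP: h => [w /not_implyP[w1 /negP]]; rewrite -ltNge => w0.
  move/existsNP: h' => [p /not_implyP[p1 /negP]]; rewrite -ltNge => p0.
  by exists p, w.
have mixed p q u v : hyperbolic A p q u v ->
    (exists m, forall z, bf B (sharp p) z = m * dot p z) ->
    (forall z, dot q z = 0 -> 0 <= Qf B z) \/ (forall z, dot q z = 0 -> Qf B z <= 0) -> False.
  move=> hpq [m hm] [h|h].
    have [h1 h2] := semidefinite_hyperplane sA sB hpq hm h nB.
    exact: kerF hpq h1 h2.
  have [||h1 h2] := @semidefinite_hyperplane A (- B) sA (symmxN sB) p q u v (- m) hpq _ _ nNB.
  - by move=> z; rewrite bfMN hm mulNr.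
  - by move=> z /h hz; rewrite QfE bfMN oppr_ge0.
  by apply: kerF hpq h1 _; move/eqP: h2; rewrite mulNmx oppr_eq0 => /eqP.
(* The zeros of [Qf A] fill exactly the two hyperplanes, so the S-lemma applies. *)
have semi p q u v : hyperbolic A p q u v -> forall B', symmx B' ->
    (forall z, dot p z = 0 -> 0 <= Qf B' z) -> (forall z, dot q z = 0 -> 0 <= Qf B' z) ->
    exists t, psd (B' + t *: A).
  move=> hpq B' sB' h1 h2; case: iA => [[x x0] [w w0]].
  apply: (S_lemma sB' sA x0 w0) => z; rewrite QfE (hyperbolic_bf z z hpq).
  move=> E; have /eqP : dot p z * dot q z = 0 by lra.
  by rewrite mulf_eq0 => /orP[] /eqP; [apply: h1 | apply: h2].
have I1 := split_indef r1; have I2 := split_indef r2.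
have M1 : (exists p w, [/\ dot r1 p = 0, dot r1 w = 0, 0 < Qf B p & Qf B w < 0]) ->
    exists m, forall z, bf B (sharp r1) z = m * dot r1 z.
  by case=> p [w [? ? ? ?]]; apply: (indefinite_hyperplane sB sC CE hA k0 vC (p := p) (w := w) (e := e)).
have M2 : (exists p w, [/\ dot r2 p = 0, dot r2 w = 0, 0 < Qf B p & Qf B w < 0]) ->
    exists m, forall z, bf B (sharp r2) z = m * dot r2 z.
  by case=> p [w [? ? ? ?]]; apply: (indefinite_hyperplane sB sC CE hA' k0 vC (p := p) (w := w) (e := e)).
case: I1 => [/M1 m1|S1]; case: I2 => [/M2 m2|S2].
- case: m1 => [m1 h1]; case: m2 => [m2 h2]; pose c := k * (m1 + m2) / 2; exists c.
  apply/eqP; rewrite -subr_eq0; apply/eqP; apply: Qf_eq0_mx.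
    by apply: symmxD => //; apply: symmxN; apply: symmxZ.
  move=> z; rewrite QfE bfMD bfMN bfMZ -(QfE C) (hyperbolic_bracket CE z hA) h1 h2.
  by rewrite (hyperbolic_bf z z hA) /c; field.
- by case: (mixed _ _ _ _ hA m1 S2).
- by case: (mixed _ _ _ _ hA' m2 S1).
case: S1 => h1; case: S2 => h2.
- by have [t /nB] := semi _ _ _ _ hA B sB h1 h2.
(* Opposite signs on the two hyperplanes clash at [e], which lies in both. *)
- by have := h1 e e1; have := h2 e e2; move=> a b; case/eqP: qe; apply/le_anti/andP.
- by have := h1 e e1; have := h2 e e2; move=> a b; case/eqP: qe; apply/le_anti/andP.
- have [||t /nNB//] := semi _ _ _ _ hA (- B) (symmxN sB).
  + by move=> z /h1 hz; rewrite QfE bfMN oppr_ge0.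
  + by move=> z /h2 hz; rewrite QfE bfMN oppr_ge0.
Qed.

End Symplectic.

(** * Ranks in a pencil and conclusion *)

Section PencilRanks.
Variables (R : realType) (n : nat) (A B : 'M[R]_n).

Lemma minrank_le M : in_span2 A B M -> M != 0 -> (minrank A B <= \rank M)%N.
Proof.
move=> sM M0; have rM : (\rank M < n.+1)%N by rewrite ltnS rank_leq_row.
rewrite /minrank; have := mem_index_enum (Ordinal rM).
elim: (index_enum _) => //= r s IH; rewrite inE big_cons.
case: ifPn => [_|hr] /orP[/eqP e|/IH h] //.
- by rewrite -e geq_minl.
- by apply: leq_trans h; apply: geq_minr.
- by case/asboolP: hr; rewrite -e; exists M.
Qed.

(** [n] is the default value of the minimum, so a smaller value must come from a member. *)
Lemma minrank_attained : (minrank A B < n)%N ->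
  exists M, [/\ in_span2 A B M, M != 0 & \rank M = minrank A B].
Proof.
move=> lt_n; pose attained x := x = n \/
  exists M, [/\ in_span2 A B M, M != 0 & \rank M = x].
suff [e|//] : attained (minrank A B) by rewrite e ltnn in lt_n.
apply: (@big_ind _ attained) => [|x y hx hy|r /asboolP hr]; [by left| |by right].
by rewrite /minn; case: ifP.
Qed.

Lemma maxrank_attained k : (k < maxrank A B)%N ->
  exists s t, (k < \rank (s *: A + t *: B)%R)%N.
Proof.
move=> lt_k; apply: contrapT => nex; move: lt_k; rewrite ltnNge => /negP; apply.
apply/bigmax_leqP => r /asboolP[M [[s [t ->]] <-]].
by rewrite leqNgt; apply/negP => h; apply: nex; exists s, t.
Qed.

(** Non-dissipativity is applied to a member and to its opposite. *)
Lemma nondissipative_indef : nondissipative A B ->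
  (forall s t, s *: A + t *: B = 0 -> s = 0 /\ t = 0) ->
  forall s t, (s != 0) || (t != 0) -> indef (s *: A + t *: B).
Proof.
move=> nd indep s t st.
have M0 : s *: A + t *: B <> 0 by case/indep => s0 t0; rewrite s0 t0 eqxx in st.
have npsd M : in_span2 A B M -> M <> 0 -> exists w, Qf M w < 0.
  move=> spM Mn; apply: contrapT => nex; apply/Mn/nd => // z.
  by rewrite leNgt; apply/negP => h; apply: nex; exists z.
split; last by apply: npsd => //; exists s, t.
have [||w w0] := npsd (- (s *: A + t *: B)).
- by exists (- s), (- t); rewrite opprD !scaleNr.
- by move/eqP; rewrite oppr_eq0 => /eqP.
by exists w; rewrite QfE bfMN -QfE oppr_lt0 in w0.
Qed.

End PencilRanks.

Theorem theorem1p5 (R : realType) (d : nat) (A B C : 'M[R]_(d + d)) :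
  symmx A -> symmx B -> nondissipative A B ->
  symmx C -> (forall z, Qf C z = pbracket (@Qf R _ A) (@Qf R _ B) z) ->
  linindep3 A B C ->
  ((3 <= minrank A B)%N /\ (17 <= maxrank A B)%N \/
   [/\ minrank A B = 2%N, (9 <= maxrank A B)%N &
       (kerAB_trivial A B \/ kerAB_symplectic A B)]) ->
  exists x : 'cV[R]_(d + d), [/\ Qf A x = 0, Qf B x = 0 & Qf C x != 0].
Proof.
move=> sA sB nd sC CE li hyp; apply: contrapT => nex.
have vC : vanishes_on_zeros A B C.
  move=> x xA xB; apply/eqP; apply: contraT => xC; case: nex; by exists x.
have CF l m : C <> l *: A + m *: B.
  move=> E; have [|_ _ /eqP] := li l m (- 1); first by rewrite scaleN1r -E subrr.
  by rewrite oppr_eq0 oner_eq0.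
have indep s t : s *: A + t *: B = 0 -> s = 0 /\ t = 0.
  by move=> E; have [|-> -> _] := li s t 0; rewrite ?scale0r ?addr0.
have hi := nondissipative_indef nd indep.
case: hyp => [[min3 max17]|[min2 max9 kerh]].
  have [||l [m E]] := pencil_vanishing_span sA sB sC hi _ _ vC; last exact: (CF l m).
  - move=> s t st; apply: leq_trans min3 _; apply: minrank_le; first by exists s, t.
    by apply/eqP => /indep[s0 t0]; rewrite s0 t0 eqxx in st.
  - by apply: maxrank_attained; apply: leq_trans max17.
(* Both alternatives on the common kernel say that [sigma] has no radical on it. *)
have kerP z : in_kerAB A B z -> (forall w, in_kerAB A B w -> sigma z w = 0) -> z = 0.
  by case: kerh => h hz; [move=> _; apply: h | apply: h].
have [s8 [t8 r8]] : exists s t, (8 < \rank (s *: A + t *: B)%R)%N by apply: maxrank_attained.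
(* This puts the minimal rank 2 below the default value [d + d]. *)
have n9 : (8 < d + d)%N by apply: leq_trans r8 (rank_leq_row _).
have [|N [[s [t NE]] N0 rN]] := @minrank_attained _ _ A B.
  by rewrite min2; apply: leq_trans n9.
rewrite min2 in rN.
have sN : symmx N by rewrite NE; apply: symmxD; apply: symmxZ.
have st : (s != 0) || (t != 0).
  apply: contraNT N0; rewrite negb_or !negbK NE => /andP[/eqP -> /eqP ->].
  by rewrite !scale0r addr0.
have iN : indef N by rewrite NE; apply: hi.
have QC z : Qf C z = 4 * sigma (A *m z) (B *m z) by rewrite CE pbracket_Qf.
have NzE z : N *m z = s *: (A *m z) + t *: (B *m z) by rewrite NE mulmxDl -!scalemxAl.
have npsd k l : (k != 0) || (l != 0) -> ~ psd (k *: A + l *: B).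
  by move=> kl; apply: indef_not_psd; apply: hi.
have four : 4 != 0 :> R by rewrite pnatr_eq0.
(* The rank-two member [N] is completed to a basis of the pencil by [A] if [s = 0], and by [B]
   otherwise. *)
have [s0|sn] := eqVneq s 0.
  have tn : t != 0 by move: st; rewrite s0 eqxx.
  have comb k l : k *: A + l *: N = k *: A + (l * t) *: B.
    by rewrite NE s0 scale0r add0r scalerA.
  (* Here [N = t *: B], and exchanging the arguments of [sigma] gives the sign in [- (4 / t)]. *)
  have [|||||||c E] := @rank2_pencil R d N A C (- (4 / t)) sN sA sC iN rN.
  - move=> k; rewrite -[A]scale1r comb; apply: npsd; by rewrite oner_neq0.
  - move=> k; rewrite -[- A]scaleN1r comb; apply: npsd; by rewrite oppr_eq0 oner_neq0.
  - exists (t8 / t), s8; rewrite addrC comb divfK //; exact: leq_trans r8.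
  - by rewrite oppr_eq0 mulf_neq0 // invr_eq0.
  - move=> z; rewrite QC NzE s0 sigma_comb mul0r add0r (sigmaC (B *m z)).
    by field.
  - move=> z Nz Az hz.
    have eq_ker w : A *m w = 0 -> B *m w = 0 <-> N *m w = 0.
      move=> Aw; rewrite NzE Aw scaler0 add0r; split=> [->|/eqP]; first by rewrite scaler0.
      by rewrite scaler_eq0 (negbTE tn) => /eqP.
    by apply: kerP => [|w [Aw Bw]]; [split=> //; apply/eq_ker | apply: hz => //; apply/eq_ker].
  - move=> x xN xA; apply: vC => //; move: xN.
    by rewrite NE s0 scale0r add0r QfE bfMZ -QfE => /eqP; rewrite mulf_eq0 (negbTE tn) => /eqP.
  by apply: (CF 0 (c * t)); rewrite E NE s0 !scale0r !add0r scalerA.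
have comb k l : k *: B + l *: N = (l * s) *: A + (k + l * t) *: B.
  by rewrite NE scalerDr !scalerA scalerDl addrCA.
have npsdB k l : k != 0 -> ~ psd (k *: B + l *: N).
  move=> kn; rewrite comb; apply: npsd; have [l0|ln] := eqVneq l 0.
    by rewrite l0 !mul0r addr0 kn orbT.
  by rewrite mulf_neq0.
(* [sigma (N *m z) (B *m z)] is [s] times [sigma (A *m z) (B *m z)], hence [4 / s]. *)
have [|||||||c E] := @rank2_pencil R d N B C (4 / s) sN sB sC iN rN.
- by move=> k; rewrite -[B]scale1r; apply: npsdB; rewrite oner_neq0.
- by move=> k; rewrite -[- B]scaleN1r; apply: npsdB; rewrite oppr_eq0 oner_neq0.
- exists (s8 / s), (t8 - s8 / s * t); rewrite addrC comb divfK // subrK; exact: leq_trans r8.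
- by rewrite mulf_neq0 // invr_eq0.
- by move=> z; rewrite QC NzE sigma_comb sigmaxx; field.
- move=> z Nz Bz hz.
  have eq_ker w : B *m w = 0 -> A *m w = 0 <-> N *m w = 0.
    move=> Bw; rewrite NzE Bw scaler0 addr0; split=> [->|/eqP]; first by rewrite scaler0.
    by rewrite scaler_eq0 (negbTE sn) => /eqP.
  by apply: kerP => [|w [Aw Bw]]; [split=> //; apply/eq_ker | apply: hz => //; apply/eq_ker].
- move=> x xN xB; apply: vC => //; move: xN.
  rewrite NE QfE bfMD !bfMZ -!QfE xB mulr0 addr0 => /eqP.
  by rewrite mulf_eq0 (negbTE sn) => /eqP.
by apply: (CF (c * s) (c * t)); rewrite E NE scalerDr !scalerA.
Qed.
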